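(* Let $r\ge 2$ be a prime, let $d\ge 1$ be an integer, and set $N:=(r-1)(d+1)$. Let $\Delta_N$ be an $N$-dimensional simplex whose vertex set $\mathcal{C}$ (with $N+1$ elements) is partitioned into $m+1$ parts (``color classes'') $\mathcal{C}=C_0\uplus\dots\uplus C_m$ with $|C_i|\le r-1$ for all $i$. Then for every continuous map $f:\Delta_N\to\mathbb{R}^d$ there are $r$ pairwise disjoint faces $F_1,\dots,F_r$ of $\Delta_N$ such that (A) $|C_i\cap F_j|\le 1$ for every $i\in\{0,\dots,m\}$ and $j\in\{1,\dots,r\}$, and (B) $f(F_1)\cap\dots\cap f(F_r)\neq\emptyset$.
   Context: Here $|C_i\cap F_j|$ denotes the number of vertices of the face $F_j$ that belong to $C_i$. Faces are disjoint if they have no common vertex. *)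

(* Defs.v *)
From HB Require Import structures.
From mathcomp Require Import all_boot all_order all_algebra.
From mathcomp Require Import all_classical all_reals all_analysis.

Set Implicit Arguments.
Unset Strict Implicit.
Unset Printing Implicit Defensive.

Import Order.TTheory GRing.Theory Num.Theory.
Import numFieldNormedType.Exports.

Local Open Scope ring_scope.

Definition affinely_independent (R : realType) (n k : nat)
    (v : 'I_k -> 'rV[R]_n) : Prop :=
  forall a : 'I_k -> R,
    \sum_i a i = 0 -> \sum_i a i *: v i = 0 -> forall i, a i = 0.

(* A face is given by its finite set F of vertex indices; this is its
   underlying point set, the convex hull of {v i | i in F}. *)
Definition face_points (R : realType) (n k : nat)
    (v : 'I_k -> 'rV[R]_n) (F : {set 'I_k}) : set 'rV[R]_n :=
  [set x | exists a : 'I_k -> R,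
     [/\ forall i, 0 <= a i,
         forall i, i \notin F -> a i = 0,
         \sum_i a i = 1
       & x = \sum_i a i *: v i]]%classic.

Definition simplex_points (R : realType) (n k : nat)
    (v : 'I_k -> 'rV[R]_n) : set 'rV[R]_n :=
  face_points v [set: 'I_k]%SET.

(* Classes are allowed to be empty. *)
Definition is_coloring (V : finType) (m : nat) (C : 'I_m.+1 -> {set V}) : Prop :=
  (forall x : V, exists i, x \in C i) /\
  (forall i j, i != j -> [disjoint C i & C j]).

(* Main.v *)
(** Write r = p + 2 and q = m + 1.  Padding every colour class to size r - 1 with
    dummy vertices and adding one more dummy, the apex, the configuration space
    is the join of r points (the positions of the apex) with K, the join of q
    chessboard complexes on (r - 1) x r squares; K is a pseudomanifold of
    dimension q(r - 1) - 1, and Z/r acts freely by shifting positions.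
    Each configuration carries q functions ("rows") on Z/r: the weights of the r
    faces, the d coordinates of f at the r points, and the weights of the dummies
    in groups of r - 1.  If all rows are constant the
    dummies have weight 0 and the r points are a Tverberg configuration.

    If the rows are never all constant, label each point by a row of largest
    oscillation and a position where this row is maximal.  On a fine subdivision
    this is an equivariant simplicial map to the join L of q copies of the
    boundary of an (r - 1)-simplex, a sphere of the same dimension as K.  The
    fundamental cycle z of K, oriented by pulling back that of L along
    (colour, slot, position) |-> (colour, position), maps to 0 as it bounds in
    the cone over K with one apex.  As L is acyclic below its top dimension, any
    two equivariant chain maps agree on z modulo r, since the discrepancy is a sum over free orbits of
    multiples of the invariant top cycle of L; but the standard map has degree
    ((r - 1)!)^q, which is nonzero modulo the prime r. *)

Require Import Defs.
From HB Require Import structures.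
From mathcomp Require Import all_boot all_order all_algebra.
From mathcomp Require Import all_classical all_reals all_analysis.
From mathcomp Require Import ring lra zify.

Set Implicit Arguments.
Unset Strict Implicit.
Unset Printing Implicit Defensive.

Import Order.TTheory GRing.Theory Num.Theory.
Import numFieldNormedType.Exports.

Local Open Scope ring_scope.

(** * Alternating chains on a finite vertex set *)

Section AlternatingChains.
Variables (T : finType) (F : fieldType).
Implicit Types (c w : seq T -> F) (s t : seq T).

(* A chain is recorded by its coefficients on ordered tuples, which turns the
   boundary into the sign-free sum [bd]; [cone a] is the exterior product with
   the vertex [a] on the left. *)
Definition alternating c :=
  (forall s1 a b s2, c (s1 ++ a :: b :: s2) = - c (s1 ++ b :: a :: s2)) /\
  (forall s1 a s2, c (s1 ++ a :: a :: s2) = 0).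

Definition bd c s := \sum_a c (a :: s).

Fixpoint cone a c s : F :=
  if s is x :: s' then (x == a)%:R * c s' - cone a (fun u => c (x :: u)) s'
  else 0.

Definition wedge s c := foldr cone c s.

(** The empty tuple counts as a simplex, so all complexes here are augmented: on the empty tuple
    [bd c] is the total coefficient of the one-vertex part of [c]. *)
Definition alt_nil s : F := (s == [::])%:R.

(** The oriented simplex on [t]. It is zero when [t] has a repetition, so simplices degenerating
    under a vertex map disappear without a case distinction. *)
Definition alt_tuple t := wedge t alt_nil.

Lemma alternating_cons c a : alternating c -> alternating (fun u => c (a :: u)).
Proof.
by case=> c1 c2; split=> [s1 x y s2|s1 x s2]; [apply: (c1 (a :: s1))|apply: (c2 (a :: s1))].
Qed.

Lemma alternating_cat c s : alternating c -> alternating (fun u => c (s ++ u)).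
Proof.
by elim: s c => [//|a s IH] c /(alternating_cons a)/IH.
Qed.

Lemma alternating_lin c1 c2 k : alternating c1 -> alternating c2 ->
  alternating (fun s => c1 s + k * c2 s).
Proof.
move=> [a1 z1] [a2 z2]; split=> [s1 a b s2|s1 a s2].
  by rewrite a1 a2 mulrN opprD.
by rewrite z1 z2 mulr0 addr0.
Qed.

Lemma alternating_front c s1 a s2 : alternating c ->
  c (s1 ++ a :: s2) = (-1) ^+ size s1 * c (a :: s1 ++ s2).
Proof.
elim: s1 c => [|b s1 IH] c Hc /=; first by rewrite mul1r.
rewrite (IH (fun u => c (b :: u))); last exact: alternating_cons.
by case: Hc => /(_ [::]) /= -> _; rewrite exprS mulN1r mulNr mulrN.
Qed.

(** The exponent is chosen before the chain, so the signs of two different chains on the same pair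
    of tuples can be compared. *)
Lemma alternating_perm s t : perm_eq s t ->
  exists e : nat, forall c, alternating c -> c s = (-1) ^+ e * c t.
Proof.
elim: s t => [|a s IH] t st.
  exists 0%N => c _; rewrite mul1r; congr c.
  by apply/esym/nilP; rewrite /nilp -(perm_size st).
have at_ : a \in t by rewrite -(perm_mem st) mem_head.
case/splitPr: at_ st => t1 t2 st.
have {st} st : perm_eq s (t1 ++ t2).
  by rewrite -(perm_cons a) (perm_trans st)// perm_catC /= perm_cons perm_catC.
have [e He] := IH _ st; exists (e + size t1)%N => c Hc.
rewrite (alternating_front _ _ _ Hc) mulrA -exprD.
rewrite (He _ (alternating_cons a Hc)) -addnA exprD -mulrA; congr (_ * _).
by rewrite addnn -muln2 exprM sqrr_sign mul1r.
Qed.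

Lemma alternating_perm0 c s t : alternating c -> perm_eq s t ->
  c t = 0 -> c s = 0.
Proof. by move=> Hc /alternating_perm[e /(_ _ Hc) ->] ->; rewrite mulr0. Qed.

Lemma alternating_uniq c s : alternating c -> c s != 0 -> uniq s.
Proof.
move=> Hc; apply: contra_neqT; elim: s c Hc => [//|a s IH] c Hc /=.
rewrite negb_and negbK => /orP[|us]; last exact: (IH _ (alternating_cons a Hc)).
case/splitPr=> s1 s2; rewrite -cat_cons (alternating_front _ _ _ Hc) /=.
by case: Hc => _ /(_ [::]) /= ->; rewrite mulr0.
Qed.

Lemma cone_cons a c x s :
  cone a c (x :: s) = (x == a)%:R * c s - cone a (fun u => c (x :: u)) s.
Proof. by []. Qed.

Lemma cone_ext a c1 c2 s : c1 =1 c2 -> cone a c1 s = cone a c2 s.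
Proof.
elim: s c1 c2 => [//|x s IH] c1 c2 E /=.
by rewrite E (IH _ (fun u => c2 (x :: u))).
Qed.

Lemma cone_lin a c1 c2 k s :
  cone a (fun u => c1 u + k * c2 u) s = cone a c1 s + k * cone a c2 s.
Proof.
elim: s c1 c2 => [|x s IH] c1 c2 /=; first by rewrite mulr0 addr0.
rewrite (IH (fun u => c1 (x :: u)) (fun u => c2 (x :: u))); ring.
Qed.

Lemma cone0 a s : cone a (fun=> 0) s = 0.
Proof. by elim: s => [//|x s /= ->]; rewrite mulr0 subr0. Qed.

Lemma coneN a c s : cone a (fun u => - c u) s = - cone a c s.
Proof.
rewrite (@cone_ext _ _ (fun u => 0 + -1 * c u)); last by move=> u; rewrite mulN1r add0r.
by rewrite cone_lin cone0 mulN1r add0r.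
Qed.

Lemma cone_sum a (I : Type) (l : seq I) (G : I -> seq T -> F) s :
  cone a (fun u => \sum_(i <- l) G i u) s = \sum_(i <- l) cone a (G i) s.
Proof.
elim: l => [|i l IH].
  by rewrite big_nil -[RHS](cone0 a s); apply: cone_ext => u; rewrite big_nil.
rewrite big_cons -IH -[X in _ + X]mul1r -cone_lin; apply: cone_ext => u.
by rewrite big_cons mul1r.
Qed.

Lemma alternating_cone a c : alternating c -> alternating (cone a c).
Proof.
move=> Hc; split.
  move=> s1; elim: s1 c Hc => [|x s1 IH] c Hc u v s2 /=; last first.
    by rewrite (IH _ (alternating_cons x Hc)) (proj1 Hc) !mulrN opprB opprK addrC.
  rewrite [X in _ - (_ - X)](@cone_ext _ _ (fun s => - c (v :: u :: s))).
    by rewrite coneN; ring.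
  by move=> s; apply: (proj1 Hc [::]).
move=> s1; elim: s1 c Hc => [|x s1 IH] c Hc u s2 /=; last first.
  by rewrite (IH _ (alternating_cons x Hc)) (proj2 Hc) mulr0 subr0.
rewrite (@cone_ext _ (fun s => c (u :: u :: s)) (fun=> 0)); last first.
  by move=> s; apply: (proj2 Hc [::]).
by rewrite cone0 subr0 subrr.
Qed.

Lemma alternating_wedge t c : alternating c -> alternating (wedge t c).
Proof. by elim: t => [//|a t IH] /IH; apply: alternating_cone. Qed.

Lemma alternating_nil : alternating alt_nil.
Proof. by split; case=> *; rewrite /alt_nil ?oppr0. Qed.

Lemma alternating_bd c : alternating c -> alternating (bd c).
Proof.
move=> Hc; split=> *; rewrite /bd.
  rewrite -sumrN; apply: eq_bigr => x _; exact: (proj1 (alternating_cons x Hc)).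
by rewrite big1// => x _; apply: (proj2 (alternating_cons x Hc)).
Qed.

(** Exchanging the two summed vertices cancels the off-diagonal terms in pairs. The diagonal terms
    need the repetition clause of [alternating], as the field may have characteristic 2. *)
Lemma bd_bd c s : alternating c -> bd (bd c) s = 0.
Proof.
move=> Hc; rewrite /bd pair_big /=.
rewrite (bigID (fun x => (enum_rank x.1 < enum_rank x.2)%N)) /=.
rewrite [X in _ + X](bigID (fun x => x.1 == x.2)) /=.
rewrite [X in _ + (X + _)]big1 ?add0r; last first.
  by case=> a b /andP[_ /eqP /= ->]; apply: (proj2 Hc [::]).
rewrite [X in _ + X](reindex_inj (h := fun x => (x.2, x.1))) /=; last first.
  by case=> a b [a' b'] [-> ->].
rewrite -[X in X + _]opprK -sumrN addrC; apply/eqP; rewrite subr_eq0; apply/eqP.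
rewrite [LHS](eq_bigl (fun x => (enum_rank x.1 < enum_rank x.2)%N)).
  by apply: eq_bigr => -[a b] _ /=; apply: (proj1 Hc [::]).
move=> [a b] /=; rewrite -leqNgt leq_eqVlt andb_orl.
rewrite (inj_eq val_inj) (inj_eq enum_rank_inj) eq_sym andbN /=.
by case: eqP => [->|]; rewrite ?ltnn ?andbT.
Qed.

(** Coning is a contracting homotopy of the full simplex on [T]; in particular it fills every cycle
    there. *)
Lemma bd_cone a c s : bd (cone a c) s = c s - cone a (bd c) s.
Proof.
rewrite /bd /= big_split /= sumrN cone_sum; congr (_ - _).
by rewrite (bigD1 a)//= eqxx mul1r big1 ?addr0// => x /negPf ->; rewrite mul0r.
Qed.

Lemma cone_supp a c s : cone a c s != 0 ->
  exists2 s', perm_eq s (a :: s') & c s' != 0.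
Proof.
elim: s c => [|x s IH] c /=; first by rewrite eqxx.
have [->|xa] := eqVneq x a; have [c0|] := eqVneq (c s) 0.
- rewrite c0 mulr0 sub0r oppr_eq0 => /IH[s' ss' cs']; exists (a :: s') => //.
  by rewrite perm_cons.
- by exists s.
- rewrite mul0r sub0r oppr_eq0 => /IH[s' ss' cs']; exists (x :: s') => //.
  rewrite (perm_trans (_ : perm_eq _ (x :: a :: s'))) ?perm_cons//.
  by rewrite (perm_catCA [:: x] [:: a] s').
- rewrite mul0r sub0r oppr_eq0 => _ /IH[s' ss' cs']; exists (x :: s') => //.
  rewrite (perm_trans (_ : perm_eq _ (x :: a :: s'))) ?perm_cons//.
  by rewrite (perm_catCA [:: x] [:: a] s').
Qed.

Lemma wedge_supp t c s : wedge t c s != 0 ->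
  exists2 s', perm_eq s (t ++ s') & c s' != 0.
Proof.
elim: t s => [|a t IH] s /=; first by exists s.
move=> /cone_supp[s1 ss1] /IH[s2 s12 cs2]; exists s2 => //.
by rewrite (perm_trans ss1)// perm_cons.
Qed.

Lemma wedge_catl t w s : uniq t ->
  (forall u, w u != 0 -> ~~ has [in t] u) ->
  wedge t w (t ++ s) = w s.
Proof.
elim: t => [//|a t IH] /= /andP[at_ ut] wt.
rewrite eqxx mul1r IH//; last first.
  by move=> u /wt; apply: contra; apply: sub_has => x; rewrite !inE => ->; rewrite orbT.
rewrite (@cone_ext _ _ (fun=> 0)) ?cone0 ?subr0// => u.
apply/eqP; apply: contraTT isT => /wedge_supp[s' /perm_mem/(_ a)].
rewrite mem_head mem_cat (negPf at_) /= => as' /wt/hasPn/(_ a).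
by rewrite -as' mem_head => /(_ isT).
Qed.

Lemma alt_tuple_supp t s : alt_tuple t s != 0 -> perm_eq s t.
Proof.
by move=> /wedge_supp[[|x s1]]; rewrite ?cats0 // /alt_nil eqxx.
Qed.

Lemma alternating_tuple t : alternating (alt_tuple t).
Proof. exact/alternating_wedge/alternating_nil. Qed.

(** The sign of the rearrangement occurs once in [c] and once in [alt_tuple], and squares to 1. *)
Lemma alt_tuple_pairing c s t : alternating c -> perm_eq s t ->
  c t * alt_tuple t s = c s.
Proof.
move=> Hc st; have [ut|nut] := boolP (uniq t); last first.
  have z u : ~~ uniq u -> c u = 0.
    by apply: contraNeq; apply: alternating_uniq.
  by rewrite (z t)// (z s) ?mul0r// (perm_uniq st).
have [e He] := alternating_perm st; rewrite (He _ Hc) (He _ (alternating_tuple t)).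
rewrite [in X in _ * (_ * X)](_ : t = t ++ [::]) ?cats0//.
rewrite -[in X in _ * (_ * X)](cats0 t) /alt_tuple cats0.
rewrite -[in X in wedge _ _ X](cats0 t) wedge_catl//.
  by rewrite /alt_nil eqxx mulr1 mulrC.
by case=> //= a u; rewrite /alt_nil eqxx.
Qed.

Lemma alternating_map c g : alternating c -> alternating (fun s => c (map g s)).
Proof.
move=> [c1 c2]; split=> *; rewrite !map_cat /=; [exact: c1|exact: c2].
Qed.

Lemma bd_map c g s : injective g ->
  bd (fun s => c (map g s)) s = bd c (map g s).
Proof. by move=> gI; rewrite /bd [RHS](reindex_inj gI). Qed.

Lemma cone_map a c g s : injective g ->
  cone (g a) c (map g s) = cone a (fun u => c (map g u)) s.
Proof.
by move=> gI; elim: s c => [//|x s IH] c /=; rewrite (inj_eq gI) IH.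
Qed.

Lemma alt_tuple_map t g s : injective g ->
  alt_tuple (map g t) (map g s) = alt_tuple t s.
Proof.
move=> gI; elim: t s => [|a t IH] s /=; first by case: s.
by rewrite cone_map//; apply: cone_ext => u; apply: IH.
Qed.

Lemma bd_catl c t s : alternating c ->
  bd (fun u => c (t ++ u)) s = (-1) ^+ size t * bd c (t ++ s).
Proof.
by move=> Hc; rewrite /bd mulr_sumr; apply: eq_bigr => x _; rewrite alternating_front.
Qed.

Lemma bd_lin c1 c2 k s :
  bd (fun s => c1 s + k * c2 s) s = bd c1 s + k * bd c2 s.
Proof. by rewrite /bd big_split mulr_sumr. Qed.

Lemma bd_ext c1 c2 s : c1 =1 c2 -> bd c1 s = bd c2 s.
Proof. by move=> E; apply: eq_bigr => x _. Qed.

End AlternatingChains.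

(** * The join of boundaries of simplices *)

Section Shift.
Variables (p : nat) (U : Type).
Implicit Types (x : U * 'I_p.+2).

Definition shift (a : 'I_p.+2) x := (x.1, x.2 + a).

Lemma shift_inj a : injective (shift a).
Proof.
move=> [i j] [i' j'] E.
by have /= -> := congr1 fst E; have /= /addIr -> := congr1 snd E.
Qed.

Lemma shift_shift a b x : shift a (shift b x) = shift (b + a) x.
Proof. by rewrite /shift /= addrA. Qed.

Lemma shift0 x : shift 0 x = x.
Proof. by case: x => i j; rewrite /shift addr0. Qed.

End Shift.

Section SphereJoin.
Variables (q p : nat) (F : fieldType).
Let T := ('I_q * 'I_p.+2)%type.
Implicit Types (c w : seq T -> F) (s t : seq T).

(** The minimal non-faces of a join of boundaries of simplices are the full rows. The bound [n] in
    [face] keeps only the first [n] factors of the join, which is what the inductions below run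
    on. *)
Definition row_full s (i : 'I_q) := [forall j, (i, j) \in s].

Definition face n s :=
  all (fun x : T => (x.1 < n)%N) s &&
  [forall i : 'I_q, (i < n)%N ==> ~~ row_full s i].

Definition sphere_chain n k c :=
  alternating c /\ forall s, c s != 0 -> face n s /\ size s = k.

Definition label_row_tail (i : 'I_q) : seq T := [seq (i, lift ord0 j) | j <- enum 'I_p.+1].
Definition label_row i : seq T := (i, ord0) :: label_row_tail i.

Lemma mem_label_row i x : (x \in label_row i) = (x.1 == i).
Proof.
rewrite inE; apply/orP/eqP => [[/eqP->//|/mapP[j _ ->]//]|<-].
case: x => k j /=; have [->|] := eqVneq j ord0; first by left.
rewrite eq_sym => /unlift_some[j' -> _].
by right; apply/mapP; exists j'; rewrite ?mem_enum.
Qed.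

Lemma size_label_row i : size (label_row i) = p.+2.
Proof. by rewrite /= size_map size_enum_ord. Qed.

Lemma label_row_uniq i : uniq (label_row i).
Proof.
rewrite /= map_inj_uniq ?enum_uniq ?andbT; last by move=> x y /(congr1 snd)/lift_inj.
by apply/mapP => -[j _ /(congr1 snd)/eqP]; rewrite (negPf (neq_lift _ _)).
Qed.

Lemma row_fullP s i : reflect {subset label_row i <= s} (row_full s i).
Proof.
apply: (iffP forallP) => [H [i' j]|H j]; last by apply: H; rewrite mem_label_row.
by rewrite mem_label_row => /eqP /= ->.
Qed.

Lemma row_full_sub s t i : {subset s <= t} -> row_full s i -> row_full t i.
Proof. by move=> st /row_fullP H; apply/row_fullP => x /H/st. Qed.

Lemma sphere_chain_lin n k c1 c2 a : sphere_chain n k c1 -> sphere_chain n k c2 ->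
  sphere_chain n k (fun s => c1 s + a * c2 s).
Proof.
move=> [a1 s1] [a2 s2]; split; first exact: alternating_lin.
move=> s; have [->|/s1//] := eqVneq (c1 s) 0.
by rewrite add0r mulf_eq0 negb_or => /andP[_ /s2].
Qed.

Lemma sphere_chain0 n k : sphere_chain n k (fun=> 0).
Proof. by split=> [|s]; [split=> *; rewrite ?oppr0|rewrite eqxx]. Qed.

Lemma perm_full_row s i : uniq s -> row_full s i ->
  exists s', perm_eq s (label_row i ++ s').
Proof.
move=> us /row_fullP H; exists [seq x <- s | x \notin label_row i].
apply: uniq_perm => //.
  rewrite cat_uniq label_row_uniq filter_uniq// andbT.
  by apply/hasPn => x; rewrite mem_filter => /andP[].
move=> x; rewrite mem_cat mem_filter; have [/H->//|//] := boolP (x \in label_row i).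
Qed.

Lemma face_size n s : (n <= q)%N -> uniq s -> face n s -> (size s <= n * p.+1)%N.
Proof.
elim: n s => [|n IH] s nq us /andP[/allP s1 /forallP s2].
  by case: s s1 us s2 => // x s /(_ x (mem_head _ _)).
pose i := Ordinal nq; rewrite -(count_predC (fun x => x.1 == i)) -!size_filter mulSn.
apply: leq_add.
  have := s2 i; rewrite /= ltnSn /= negb_forall => /existsP[j ijs].
  have /uniq_leq_size : uniq ((i, j) :: [seq x <- s | x.1 == i]).
    by rewrite /= filter_uniq// mem_filter (negPf ijs) andbF.
  move=> /(_ (label_row i)); rewrite size_label_row; apply=> x.
  by rewrite inE mem_label_row mem_filter => /orP[/eqP->//|/andP[]].
apply: IH (ltnW nq) _ _; first exact: filter_uniq.
apply/andP; split.
  apply/allP => x; rewrite mem_filter /= => /andP[xi /s1].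
  by rewrite ltnS leq_eqVlt => /orP[|//] /eqP xn; case/eqP: xi; apply: val_inj.
apply/forallP => k; apply/implyP => kn.
have := implyP (s2 k) (ltnW kn); apply: contra; apply: row_full_sub.
by move=> x; rewrite mem_filter => /andP[].
Qed.

Lemma sphere_chain_size0 k c : (q * p.+1 < k)%N -> sphere_chain q k c -> forall s, c s = 0.
Proof.
move=> kq [ac sc] s; apply: contraTeq kq => cs.
have [fs <-] := sc _ cs; rewrite -leqNgt face_size//.
exact: alternating_uniq ac cs.
Qed.

(* Coning with the vertex [(n, 0)] keeps the rows below [n] nonfull; only row
   [n] can become full, which is what "wide" allows. *)
Section Step.
Variables (n : nat) (nq : (n < q)%N).
Let i := Ordinal nq.

(** The part of [u] lying over the full row [n], seen as a chain of the link of that row, the join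
    of the rows below. It is the only obstruction for a wide chain to be a chain of the join. *)
Definition contract (u : seq T -> F) s := u (label_row i ++ s).

Lemma face_wide s : face n.+1 s =
  [&& all (fun x : T => (x.1 < n.+1)%N) s, ~~ row_full s i &
   [forall k : 'I_q, (k < n)%N ==> ~~ row_full s k]].
Proof.
rewrite /face; congr andb; apply/forallP/andP => [H|[H1 /forallP H2] k].
  split; first by have := H i; rewrite /= ltnSn.
  by apply/forallP => k; apply/implyP => kn; apply: (implyP (H k)); apply: ltnW.
apply/implyP; rewrite ltnS leq_eqVlt => /orP[/eqP kn|]; last exact/implyP.
by rewrite (_ : k = i)//; apply: val_inj.
Qed.

Definition wide_face s := all (fun x : T => (x.1 < n.+1)%N) s &&
   [forall k : 'I_q, (k < n)%N ==> ~~ row_full s k].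

Definition wide_chain k c :=
  alternating c /\ forall s, c s != 0 -> wide_face s /\ size s = k.

Lemma wide_face_sub s t : {subset s <= t} -> wide_face t -> wide_face s.
Proof.
move=> st /andP[/allP t1 /forallP t2]; apply/andP; split.
  by apply/allP => x /st/t1.
apply/forallP => k; apply/implyP => /(implyP (t2 k)); apply: contra.
exact: row_full_sub.
Qed.

Lemma wide_row_cat l s : {subset l <= label_row i} ->
  face n s -> wide_face (l ++ s).
Proof.
move=> li /andP[/allP s1 /forallP s2]; apply/andP; split.
  apply/allP => x; rewrite mem_cat => /orP[/li|/s1/ltnW//].
  by rewrite mem_label_row => /eqP->/=.
apply/forallP => k; apply/implyP => kn.
apply: contra (implyP (s2 k) kn) => /row_fullP H; apply/row_fullP => x xk.
have := H _ xk; rewrite mem_cat => /orP[/li|//].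
move: xk; rewrite !mem_label_row => /eqP-> /eqP ki.
by move: kn; rewrite ki ltnn.
Qed.

Lemma wide_chain_wedge l k c : {subset l <= label_row i} -> sphere_chain n k c ->
  wide_chain (size l + k) (wedge l c).
Proof.
move=> li [ac sc]; split; first exact: alternating_wedge.
move=> s /wedge_supp[s' ss' /sc[fs' <-]]; split; last first.
  by rewrite (perm_size ss') size_cat.
apply: wide_face_sub (wide_row_cat li fs') => x.
by rewrite (perm_mem ss').
Qed.

Lemma wide_chain_cone k c : sphere_chain n.+1 k c ->
  wide_chain k.+1 (cone (i, ord0) c).
Proof.
move=> [ac sc]; split; first exact: alternating_cone.
move=> s /cone_supp[s' ss' /sc[fs' <-]]; split; last by rewrite (perm_size ss').
move: fs'; rewrite face_wide => /and3P[s1 _ /forallP s2]; apply/andP; split.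
  by rewrite (perm_all _ ss') /= s1 ltnSn.
apply/forallP => a; apply/implyP => an.
apply: contra (implyP (s2 a) an) => /row_fullP H; apply/row_fullP => x xa.
have := H _ xa; rewrite (perm_mem ss') inE => /orP[/eqP xi|//].
by move: xa an; rewrite xi mem_label_row /= => /eqP <-; rewrite ltnn.
Qed.

Lemma contract_sphere_chain k u : wide_chain (p.+2 + k) u -> sphere_chain n k (contract u).
Proof.
move=> [au su]; split; first exact: alternating_cat.
move=> s us; have [ws] := su _ us; rewrite size_cat size_label_row => /addnI ks; split=> //.
have /andP[/allP s1 s2] := wide_face_sub (mem_subseq (suffix_subseq (label_row i) s)) ws.
rewrite /face s2 andbT; apply/allP => x xs.
have := s1 _ xs; rewrite ltnS leq_eqVlt => /orP[/eqP xn|//].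
have := alternating_uniq au us; rewrite cat_uniq => /and3P[_ /hasPn/(_ _ xs)].
by rewrite mem_label_row; case: eqP => // -[]; apply: val_inj.
Qed.

Lemma wide_chain_face k u : wide_chain k u ->
  (forall s, contract u s = 0) -> sphere_chain n.+1 k u.
Proof.
move=> [au su] u0; split=> // s us; have [ws ks] := su _ us; split=> //.
have /andP[s1 s2] := ws; rewrite face_wide s1 s2 andbT /=.
apply/negP => /(perm_full_row (alternating_uniq au us))[s' ss'].
by case/eqP: us; apply: (alternating_perm0 au ss'); apply: u0.
Qed.

Lemma bd_wide_chain k u : wide_chain k.+1 u -> wide_chain k (bd u).
Proof.
move=> [au su]; split; first exact: alternating_bd.
move=> s; rewrite /bd => s0.
have [a ua] : exists a, u (a :: s) != 0.
  apply/existsP; apply: contraNT s0; rewrite negb_exists => /forallP H.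
  by rewrite big1// => a _; apply/eqP; have := H a; rewrite negbK.
have [wa [ks]] := su _ ua; split=> //.
by apply: wide_face_sub wa => x xs; rewrite inE xs orbT.
Qed.

Lemma wide_chain_lin k c1 c2 a : wide_chain k c1 -> wide_chain k c2 ->
  wide_chain k (fun s => c1 s + a * c2 s).
Proof.
move=> [a1 s1] [a2 s2]; split; first exact: alternating_lin.
move=> s; have [->|/s1//] := eqVneq (c1 s) 0.
by rewrite add0r mulf_eq0 negb_or => /andP[_ /s2].
Qed.

Lemma bd_contract u s : alternating u ->
  bd (contract u) s = (-1) ^+ p.+2 * contract (bd u) s.
Proof. by move=> au; rewrite /contract bd_catl// size_label_row. Qed.

Lemma contract_wedge k w s : sphere_chain n k w -> wedge (label_row i) w (label_row i ++ s) = w s.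
Proof.
move=> [aw sw]; apply: wedge_catl; first exact: label_row_uniq.
move=> t /sw[/andP[/allP t1 _] _]; apply/hasPn => x /t1 xn.
by rewrite -[~~ _]/(x \notin label_row _) mem_label_row; apply/eqP => xi; move: xn; rewrite xi ltnn.
Qed.

Lemma contract_face k c s : sphere_chain n.+1 k c -> c (label_row i ++ s) = 0.
Proof.
move=> [ac sc]; apply/eqP; apply: contraTT isT => /sc[]; rewrite face_wide => /and3P[_ + _].
by move/negP; case; apply/row_fullP => x; rewrite mem_cat => ->.
Qed.

End Step.

(** Cone the cycle off from [(n, 0)]. The contraction of this cone is a cycle of the join of fewer
    rows, below its top dimension, so it bounds by induction, and the filling is used to remove the
    full row. *)
Lemma sphere_chain_acyclic n k c : (n <= q)%N -> (k < n * p.+1)%N -> sphere_chain n k c ->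
  (forall s, bd c s = 0) ->
  exists2 u, sphere_chain n k.+1 u & forall s, bd u s = c s.
Proof.
elim: n k c => [//|n IH] k c nq kn Lc c0.
have := wide_chain_cone nq Lc; set u := cone _ c => wu.
have uE s : bd u s = c s.
  by rewrite bd_cone (cone_ext _ _ c0) cone0 subr0.
(* In low degree a tuple is too short to contain a full row, and the cone itself is the filling. *)
have [kp|pk] := ltnP k.+1 p.+2.
  exists u => //; apply: (wide_chain_face (wu)) => s.
  apply/eqP; apply: contraLR kp => us; rewrite -leqNgt.
  by have [_ <-] := proj2 wu (label_row _ ++ s) us; rewrite size_cat size_label_row leq_addr.
have kE : k.+1 = (p.+2 + (k.+1 - p.+2))%N by rewrite subnKC.
rewrite kE in wu; have Lu := contract_sphere_chain nq wu.
have [|s|v Lv vE] := IH _ _ (ltnW nq) _ Lu; first by move: kn pk; lia.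
  rewrite bd_contract; last exact: (proj1 wu).
  by rewrite [X in _ * X]uE (contract_face nq s Lc) mulr0.
have wv : wide_chain n (p.+2 + (k.+1 - p.+2)) (bd (wedge (label_row (Ordinal nq)) v)).
  apply: bd_wide_chain; have := wide_chain_wedge (nq := nq) (fun _ h => h) Lv.
  by rewrite size_label_row addnS.
have av : alternating (wedge (label_row (Ordinal nq)) v) by apply/alternating_wedge/(proj1 Lv).
(* Subtracting a boundary does not change [bd u]. The sign is the one of [bd_contract], so that the
   two contractions cancel. *)
exists (fun s => u s + - (-1) ^+ p.+2 * bd (wedge (label_row (Ordinal nq)) v) s).
  rewrite kE; apply: wide_chain_face; first exact: wide_chain_lin.
  move=> s; have := bd_contract nq s av; rewrite /contract mulNr => <-.
  rewrite (@bd_ext _ _ _ v) ?vE ?subrr// => t.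
  exact: contract_wedge Lv.
by move=> s; rewrite bd_lin bd_bd// mulr0 addr0.
Qed.

(** The reference facet, consisting of the nonzero positions of the first [n] rows; top cycles are
    compared by their coefficient on it. [insub] only converts the recursion index into a row. *)
Fixpoint facet n : seq T :=
  if n is n'.+1 then
    if insub n' is Some i then label_row_tail i ++ facet n' else facet n'
  else [::].

Lemma facetS n (nq : (n < q)%N) : facet n.+1 = label_row_tail (Ordinal nq) ++ facet n.
Proof. by rewrite /= insubT. Qed.

Lemma mem_facet n x : (n <= q)%N -> (x \in facet n) = (x.1 < n)%N && (x.2 != ord0).
Proof.
elim: n => [//|n IH] nq; rewrite facetS mem_cat IH; last exact: ltnW.
have -> : (x \in label_row_tail (Ordinal nq)) = (x.1 == Ordinal nq) && (x.2 != ord0).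
  have := mem_label_row (Ordinal nq) x; rewrite inE.
  have /= /andP[/negP r0 _] := label_row_uniq (Ordinal nq).
  case: x {IH} => k j /=; have [->|j0] := eqVneq j ord0; last first.
    by rewrite -pair_eqE /= (negPf j0) andbF /= andbT.
  by rewrite andbF => _; apply/negP; have [->|ki /mapP[? _ []]] := eqVneq k (Ordinal nq).
by rewrite -andb_orl ltnS [in RHS]leq_eqVlt.
Qed.

(** The contraction of the cone over [c] is a top cycle of the smaller join vanishing on its
    reference facet, hence zero by induction. So the cone lies in the join, one degree above the
    top, and vanishes together with its boundary [c]. *)
Lemma top_cycle_inj n c : (n <= q)%N -> sphere_chain n (n * p.+1) c ->
  (forall s, bd c s = 0) -> c (facet n) = 0 -> forall s, c s = 0.
Proof.
elim: n c => [|n IH] c nq Lc c0 cf.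
  by case=> [//|x s]; apply/eqP; apply: contraTT isT => /(proj2 Lc)[_].
have := wide_chain_cone nq Lc; set u := cone _ c => wu.
have uE s : bd u s = c s.
  by rewrite bd_cone (cone_ext _ _ c0) cone0 subr0.
have kE : (n.+1 * p.+1).+1 = (p.+2 + n * p.+1)%N by lia.
rewrite kE in wu; have Lu := contract_sphere_chain nq wu.
have u0 : forall s, contract nq u s = 0.
  apply: IH (ltnW nq) Lu _ _ => [s|].
    rewrite bd_contract; last exact: (proj1 wu).
    by rewrite [X in _ * X]uE (contract_face nq s Lc) mulr0.
  rewrite /contract
    -[label_row _ ++ _]/((Ordinal nq, ord0) :: (label_row_tail (Ordinal nq) ++ facet n)).
  rewrite -facetS /u cone_cons cf mulr0 sub0r.
  apply/eqP; rewrite oppr_eq0; apply: contraTT isT.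
  move=> /cone_supp[s' /perm_mem/(_ (Ordinal nq, ord0)) + _].
  by rewrite mem_head mem_facet// andbF.
have Lu' : sphere_chain n.+1 (p.+2 + n * p.+1) u by apply: wide_chain_face wu u0.
move=> s; rewrite -uE /bd big1// => a _.
apply/eqP; apply: contraTT isT => ua.
have [fa sa] := proj2 Lu' _ ua.
have := face_size nq (alternating_uniq (proj1 Lu') ua) fa.
by rewrite sa -kE ltnn.
Qed.

(** The previous chain being a cycle, the boundary only hits the row factor: this is the exterior
    product of the boundary of each full row with the cycle below, scaled to be 1 on [facet]. *)
Fixpoint fundamental n : seq T -> F :=
  if n is n'.+1 then
    if insub n' is Some i then bd (wedge (label_row i) (fundamental n'))
    else fundamental n'
  else @alt_nil T F.

Lemma fundamentalS n (nq : (n < q)%N) :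
  fundamental n.+1 = bd (wedge (label_row (Ordinal nq)) (fundamental n)).
Proof. by rewrite /= insubT. Qed.

Lemma fundamentalP n : (n <= q)%N ->
  [/\ sphere_chain n (n * p.+1) (fundamental n),
      forall s, bd (fundamental n) s = 0 & fundamental n (facet n) = 1].
Proof.
elim: n => [|n IH] nq.
  split; last by rewrite /= /alt_nil eqxx.
    split=> [|[|x s]] /=; rewrite /alt_nil ?eqxx//; first exact: alternating_nil.
    by move=> _; split=> //; rewrite /face /=; apply/forallP.
  by move=> s; rewrite /bd big1.
have [Lf f0 f1] := IH (ltnW nq); rewrite facetS fundamentalS.
set i := Ordinal nq; set w := wedge _ _; have aw : alternating w.
  by apply/alternating_wedge/(proj1 Lf).
have ww : wide_chain n (n.+1 * p.+1).+1 w.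
  have := wide_chain_wedge (nq := nq) (fun _ h => h) Lf.
  by rewrite size_label_row mulSn.
split; first 1 last.
- by move=> s; apply: bd_bd.
- rewrite /bd (bigD1 (i, ord0))// big1; last first.
  move=> x xi; apply/eqP; apply: contraNT xi => /wedge_supp[s' /perm_mem/(_ (i, ord0))].
    rewrite mem_cat mem_head inE mem_cat => /orP[/eqP->//|/orP[|]].
      by have /= /andP[/negPf->] := label_row_uniq i.
    by rewrite mem_facet ?(ltnW nq)// andbF.
  by rewrite /= addr0; exact: etrans (contract_wedge nq _ Lf) f1.
- apply: wide_chain_face; first exact: bd_wide_chain ww.
  move=> s; have := bd_contract nq s aw; rewrite /contract.
  rewrite (@bd_ext _ _ _ (fundamental n)) ?f0; last by move=> t; exact: (contract_wedge nq _ Lf).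
  by move/esym/eqP; rewrite mulf_eq0 signr_eq0 => /eqP.
Qed.

Hypothesis charF : p.+2 \in [pchar F].

Lemma row_full_shift a s i : row_full (map (shift a) s) i = row_full s i.
Proof.
apply/forallP/forallP => H j; last first.
  have -> : (i, j) = shift a (i, j - a) by rewrite /shift subrK.
  by rewrite mem_map//; exact: shift_inj.
have := H (j + a); rewrite -[(i, j + a)]/(shift a (i, j)).
by rewrite mem_map//; exact: shift_inj.
Qed.

Lemma face_shift n a s : face n (map (shift a) s) = face n s.
Proof.
rewrite /face all_map; congr andb.
by apply: eq_forallb => i; rewrite row_full_shift.
Qed.

Lemma sphere_chain_shift n k a c : sphere_chain n k c ->
  sphere_chain n k (fun s => c (map (shift a) s)).
Proof.
move=> [ac sc]; split; first exact: alternating_map.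
by move=> s /sc; rewrite face_shift size_map.
Qed.

(* Top cycles form a line, on which the shift by [a] acts by a scalar whose
   [r]-th power is [1]; in characteristic [r] this scalar is [1]. *)
Lemma top_cycle_shift c a s : sphere_chain q (q * p.+1) c ->
  (forall s, bd c s = 0) -> c (map (shift a) s) = c s.
Proof.
move=> Lc c0; have [cf|cf] := eqVneq (c (facet q)) 0.
  by rewrite !(top_cycle_inj (leqnn q) Lc c0 cf).
pose k := c (map (shift a) (facet q)) / c (facet q).
have kE t : c (map (shift a) t) = k * c t.
  apply/eqP; rewrite -subr_eq0 -mulNr; apply/eqP.
  apply: (@top_cycle_inj q (fun t => c (map (shift a) t) + - k * c t)) => //.
  - exact/sphere_chain_lin/Lc/sphere_chain_shift.
  - by move=> u; rewrite bd_lin bd_map ?c0 ?mulr0 ?addr0//; exact: shift_inj.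
  - by rewrite mulNr mulfVK// subrr.
have kn m t : c (map (shift (a *+ m)) t) = k ^+ m * c t.
  elim: m t => [|m IH] t.
    rewrite mul1r -[in RHS](map_id t); congr c; apply: eq_map => -[i j].
    by rewrite /shift addr0.
  rewrite exprS -mulrA -IH -kE -map_comp; congr c; apply: eq_map => -[i j].
  by rewrite /shift /= mulrSr addrA.
have k1 : k ^+ p.+2 = 1.
  have := kn p.+2 (facet q).
  have -> : a *+ p.+2 = a *+ 0.
    by rewrite mulr0n Zp_mulrn; apply: val_inj; rewrite /= modnMl.
  by rewrite kn mul1r -[LHS]mul1r => /(mulIf cf).
have {}k1 : k = 1.
  have : (k - 1) ^+ p.+2 == 0.
    by rewrite -(pFrobenius_autE charF) rmorphB rmorph1 /= pFrobenius_autE k1 subrr.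
  by rewrite expf_eq0 /= subr_eq0 => /eqP.
by rewrite kE k1 mul1r.
Qed.

End SphereJoin.

(** * Chessboard complexes and equivariant chain maps *)

(** Values may themselves be chains: a chain map given on tuples is a function [Phi] for which
    [bd (Phi t)] is [cobd Phi t]. *)
Fixpoint cobd (V : zmodType) (A : Type) (phi : seq A -> V) (t : seq A) : V :=
  if t is a :: t' then phi t' - cobd (fun u => phi (a :: u)) t' else 0.

Section Coboundary.
Variables (V : zmodType) (A : eqType).
Implicit Types (phi psi : seq A -> V) (t : seq A).

Lemma eq_cobd phi psi t :
  (forall u, subseq u t -> (size u).+1 = size t -> phi u = psi u) ->
  cobd phi t = cobd psi t.
Proof.
elim: t phi psi => [//|a t IH] phi psi E /=; rewrite E ?subseq_cons//.
congr (_ - _); apply: IH => u ut su; apply: E => /=; first by rewrite eqxx.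
by rewrite su.
Qed.

Lemma cobdB phi psi t :
  cobd (fun u => phi u - psi u) t = cobd phi t - cobd psi t.
Proof.
elim: t phi psi => [|a t IH] phi psi /=; first by rewrite subr0.
rewrite (IH (fun u => phi (a :: u))) !opprB [X in _ + X]addrC addrACA.
by rewrite [X in _ + X]addrC.
Qed.

Lemma cobd_cobd phi t : cobd (cobd phi) t = 0.
Proof.
elim: t phi => [//|a t IH] phi /=.
by rewrite (cobdB phi) IH subr0 subrr.
Qed.

Lemma cobd_morph (W : zmodType) (f : V -> W) phi t :
  (forall x y, f (x - y) = f x - f y) -> f (cobd phi t) = cobd (f \o phi) t.
Proof.
move=> fB; elim: t phi => [|a t IH] phi /=; last by rewrite fB IH.
by rewrite -[0](subrr 0) fB subrr.
Qed.

Lemma cobd_closed (Q : V -> Prop) phi t : Q 0 ->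
  (forall x y, Q x -> Q y -> Q (x - y)) ->
  (forall u, subseq u t -> (size u).+1 = size t -> Q (phi u)) -> Q (cobd phi t).
Proof.
move=> Q0 QB; elim: t phi => [//|a t IH] phi Qp /=; apply: QB.
  by apply: Qp; rewrite ?subseq_cons.
by apply: IH => u ut su; apply: Qp => /=; rewrite ?eqxx ?su.
Qed.

End Coboundary.

Lemma cobd_map (V : zmodType) (A B : Type) (g : A -> B) (phi : seq B -> V) t :
  cobd phi (map g t) = cobd (fun u => phi (map g u)) t.
Proof.
by elim: t phi => [//|a t IH] phi /=; rewrite IH.
Qed.

Lemma cobd_sum (F : nzRingType) (A : Type) (phi : seq A -> F) t :
  cobd phi t = \sum_(i < size t) (-1) ^+ i * phi (take i t ++ drop i.+1 t).
Proof.
elim: t phi => [|a t IH] phi; first by rewrite big_ord0.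
rewrite [LHS]/= -[size (a :: t)]/((size t).+1) big_ord_recl mul1r /= drop0
  (IH (fun u => phi (a :: u))) -sumrN; congr (_ + _).
by apply: eq_bigr => i _; rewrite exprS mulN1r mulNr.
Qed.

Section Chessboard.
Variables (q p : nat) (F : fieldType).
Let T := ('I_q * 'I_p.+2)%type.
Definition slot : finType := ('I_q * 'I_p.+1)%type.

Let B := (slot * 'I_p.+2)%type.
Let A := (option slot * 'I_p.+2)%type.

Definition label (b : B) : T := (b.1.1, b.2).
Definition emb (b : B) : A := (Some b.1, b.2).

(* Chessboard condition: distinct slots, and distinct (colour, position)
   pairs; [None] is the apex of the cone and has a colour of its own. *)
Definition cface (t : seq A) :=
  uniq (map fst t) && uniq (map (fun x : A => (omap fst x.1, x.2)) t).

Definition bface (t : seq B) := uniq (map fst t) && uniq (map label t).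

Lemma cface_emb t : cface (map emb t) = bface t.
Proof.
rewrite /cface /bface -!map_comp; congr andb.
  have I : injective (@Some slot) by move=> ? ? [].
  by rewrite -[RHS](map_inj_uniq I) -map_comp.
have I : injective (fun x : T => (Some x.1, x.2)) by move=> [? ?] [? ?] [-> ->].
by rewrite -(map_inj_uniq I) -map_comp.
Qed.

Lemma cface_cone t : bface t -> cface ((None, 0) :: map emb t).
Proof.
rewrite -cface_emb => /andP[t1 t2]; rewrite /cface /= t1 t2 !andbT.
by apply/andP; split; apply/mapP => -[x /mapP[b _ ->]].
Qed.

Lemma bface_subseq u t : subseq u t -> bface t -> bface u.
Proof.
by move=> ut /andP[t1 t2]; rewrite /bface (subseq_uniq _ t1) ?map_subseq//=
  (subseq_uniq _ t2)// map_subseq.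
Qed.

Lemma map_label_shift a t : map label (map (shift a) t) = map (shift a) (map label t).
Proof. by rewrite -!map_comp. Qed.

Lemma map_emb_shift a t : map emb (map (shift a) t) = map (shift a) (map emb t).
Proof. by rewrite -!map_comp. Qed.

Lemma bface_shift a t : bface (map (shift a) t) = bface t.
Proof.
rewrite /bface map_label_shift -map_comp (map_inj_uniq (@shift_inj p _ a)).
by congr (uniq _ && _); apply: eq_map.
Qed.

Lemma map_shift a b (s : seq T) :
  map (shift a) (map (shift b) s) = map (shift (b + a)) s.
Proof. by rewrite -map_comp; apply: eq_map => x; apply: shift_shift. Qed.

Lemma map_shift0 (s : seq T) : map (shift 0) s = s.
Proof. by rewrite -[RHS]map_id; apply: eq_map => x; apply: shift0. Qed.

(** A colour has only [p.+1] slots, each used at most once, so it cannot occupy all [p.+2] positions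
    of its row. *)
Lemma sphere_chain_standard t : bface t -> sphere_chain q (size t) (@alt_tuple T F (map label t)).
Proof.
move=> /andP[t1 t2]; split; first exact: alternating_tuple.
move=> s /alt_tuple_supp st; split; last by rewrite (perm_size st) size_map.
apply/andP; split; first by apply/allP => x _.
apply/forallP => i; apply/implyP => _; apply/row_fullP => H.
pose ti := [seq b <- t | b.1.1 == i].
have : (size (label_row p i) <= size (map label ti))%N.
  apply: uniq_leq_size; first exact: label_row_uniq.
  move=> x xi; have := H _ xi; rewrite (perm_mem st) => /mapP[b bt xb].
  by apply/mapP; exists b => //; rewrite mem_filter bt andbT; move: xi; rewrite mem_label_row xb.
rewrite size_label_row size_map leqNgt ltnS => /negP; apply.
pose sl := map fst ti; rewrite -(size_map fst) -/sl -(size_map snd).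
apply: (@leq_trans (size (enum 'I_p.+1))); last by rewrite size_enum_ord.
apply: uniq_leq_size; last by move=> x _; rewrite mem_enum.
rewrite map_inj_in_uniq; first by apply: subseq_uniq t1; rewrite map_subseq// filter_subseq.
have sli x : x \in sl -> x.1 = i.
  by case/mapP => b; rewrite mem_filter => /andP[/eqP + _] -> => <-.
by move=> [i1 k1] [i2 k2] /sli /= -> /sli /= -> ->.
Qed.

(** Facets of the chessboard join use every slot, so functions on the slots enumerate them.
    Functions that do not give a face are kept: [omega] weighs them 0. *)
Definition placement (pi : {ffun slot -> 'I_p.+2}) : seq B := [seq (v, pi v) | v <- enum slot].

Local Notation omega := (@fundamental q p F q).

Lemma size_placement pi : size (placement pi) = (q * p.+1)%N.
Proof. by rewrite size_map -cardE card_prod !card_ord. Qed.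

Lemma alternating_omega : alternating omega.
Proof. by have [[]] := fundamentalP p F (leqnn q). Qed.

Lemma omega_bface pi : omega (map label (placement pi)) != 0 -> bface (placement pi).
Proof.
move=> H; rewrite /bface (alternating_uniq alternating_omega H) andbT.
by rewrite -map_comp map_id enum_uniq.
Qed.

(* The two facets of the complex containing a ridge differ by the position of
   a single slot, so this is the cycle condition for [omega]. *)
Lemma omega_slot (l1 l2 : seq slot) v (g : slot -> 'I_p.+2) : l1 ++ v :: l2 = enum slot ->
  \sum_j omega ([seq label (w, g w) | w <- l1] ++
    label (v, j) :: [seq label (w, g w) | w <- l2]) = 0.
Proof.
move=> lE; set s1 := map _ l1; set s2 := map _ l2.
have [[_ fw] /(_ (s1 ++ s2)) w0 _] := fundamentalP p F (leqnn q).
under eq_bigr do rewrite (alternating_front _ _ _ alternating_omega).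
rewrite -mulr_sumr; apply/eqP; rewrite mulf_eq0; apply/orP; right; apply/eqP.
rewrite -[RHS]w0 /bd [RHS](bigID (fun x => x.1 == v.1)) /= [X in _ + X]big1 ?addr0.
  rewrite (reindex_onto (fun j => (v.1, j)) snd) /=; last by case=> i j /eqP /= ->.
  by apply: eq_big => [j|//]; rewrite !eqxx.
(* A new vertex of a colour other than that of [v] would fill its row, since all [p.+1] slots of
   that colour are still placed. *)
move=> [i j] /= iv; apply/eqP; apply: contraTT isT => w_ne0.
have uw := alternating_uniq alternating_omega w_ne0.
have [/andP[_ /forallP/(_ i)/implyP/(_ (ltn_ord i)) /negP nf] _] := fw _ w_ne0.
case: nf; apply/row_fullP => x xi; move: uw; set s := _ :: _ => us.
have fu : uniq [seq x <- s | x.1 == i] by apply: filter_uniq.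
suff sz : (size (label_row p i) <= size [seq x <- s | x.1 == i])%N.
  have [|_ /(_ x)] := uniq_min_size fu _ sz.
    by move=> y; rewrite mem_filter mem_label_row => /andP[].
  by rewrite xi mem_filter => /andP[].
rewrite size_label_row /= eqxx /= ltnS /s1 /s2 -map_cat filter_map size_map.
have : (size [seq (i, k) | k <- enum 'I_p.+1] <= size [seq w <- l1 ++ v :: l2 | w.1 == i])%N.
  apply: uniq_leq_size; first by rewrite map_inj_uniq ?enum_uniq// => ? ? [].
  by move=> _ /mapP[k _ ->]; rewrite mem_filter lE mem_enum eqxx.
rewrite size_map size_enum_ord !filter_cat /= (eq_sym v.1) (negPf iv).
by under [in X in _ -> X]eq_filter do rewrite /=.
Qed.

End Chessboard.

(** * Nonexistence of an equivariant chain map, by a degree count modulo r *)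

Section NoChainMap.
Variables (q p : nat) (F : fieldType).
Hypothesis q_gt0 : (0 < q)%N.
Hypothesis charF : p.+2 \in [pchar F].
Let T := ('I_q * 'I_p.+2)%type.
Local Notation slot := (slot q p).
Let B := (slot * 'I_p.+2)%type.
Let A := (option slot * 'I_p.+2)%type.
Local Notation omega := (@fundamental q p F q).

(** The placements weighted by [omega] form a cycle, stated by pairing with an arbitrary cochain:
    for each deleted slot, [omega_slot] kills the sum over its positions. *)
Lemma placement_cycle (psi : seq B -> F) :
  \sum_pi omega (map (@label q p) (placement pi)) * cobd psi (placement pi) = 0.
Proof.
under eq_bigr do rewrite cobd_sum size_placement mulr_sumr.
rewrite exchange_big big1//= => i _.
have iS : (i < size (enum slot))%N by rewrite -cardE card_prod !card_ord.
have v0 : slot by rewrite -cardE in iS; exact: (enum_val (Ordinal iS)).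
pose l1 := take i (enum slot); pose v := nth v0 (enum slot) i; pose l2 := drop i.+1 (enum slot).
have lE : l1 ++ v :: l2 = enum slot by rewrite -drop_nth// cat_take_drop.
have : uniq (l1 ++ v :: l2) by rewrite lE enum_uniq.
rewrite cat_uniq => /and3P[_ /norP[/= vl1 _] /andP[vl2 _]].
pose upd (pi : {ffun slot -> 'I_p.+2}) j := [ffun w => if w == v then j else pi w].
(* Placements that differ only at the deleted slot [v] are grouped under the one with [v] at
   position 0; the other values of [rho] have empty fibres. *)
rewrite (partition_big (fun pi => upd pi 0) predT)//= big1// => rho _.
have [rE|rE] := eqVneq (upd rho 0) rho; last first.
  rewrite big1// => pi /eqP rpi; case/eqP: rE; rewrite -rpi.
  by apply/ffunP => w; rewrite !ffunE; case: eqP.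
rewrite (reindex_onto (upd rho) (fun pi => pi v)) /=; last first.
  move=> pi /eqP rpi; apply/ffunP => w; rewrite !ffunE; case: eqP => [->//|wv].
  by rewrite -rpi ffunE; case: eqP.
under eq_bigl => j.
  have -> : (upd (upd rho j) 0 == rho) && (upd rho j v == j).
    apply/andP; split; last by rewrite ffunE eqxx.
    rewrite -[X in _ == X]rE; apply/eqP/ffunP => w; rewrite !ffunE; by case: eqP.
  over.
have updE j (l : seq slot) : v \notin l ->
    [seq (w, upd rho j w) | w <- l] = [seq (w, rho w) | w <- l].
  move=> vl; apply/eq_in_map => w wl; rewrite ffunE.
  by case: eqP => // wv; move: vl; rewrite -wv wl.
have pE j : placement (upd rho j) =
    [seq (w, rho w) | w <- l1] ++ (v, j) :: [seq (w, rho w) | w <- l2].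
  by rewrite /placement -lE map_cat /= !updE// ffunE eqxx.
have si : size [seq (w, rho w) | w <- l1] = i by rewrite size_map size_takel// ltnW.
under eq_bigr => j _.
  rewrite pE take_size_cat// -cat_rcons drop_size_cat ?size_rcons ?si//.
  rewrite cat_rcons map_cat /=; over.
rewrite -mulr_suml; apply/eqP; rewrite mulf_eq0; apply/orP; left; apply/eqP.
have := omega_slot F rho lE; rewrite -!map_comp; exact.
Qed.

(** Shifting changes the position of the slot [v0], so orbits have exactly [p.+2] members, and an
    invariant sum is a multiple of the characteristic. *)
Lemma sum_free (G : {ffun slot -> 'I_p.+2} -> F) :
  (forall a (pi : {ffun slot -> 'I_p.+2}), G [ffun w => pi w + a] = G pi) -> \sum_pi G pi = 0.
Proof.
move=> GE; pose v0 : slot := (Ordinal q_gt0, ord0).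
rewrite (partition_big (fun pi : {ffun slot -> 'I_p.+2} => pi v0) predT)//=.
transitivity (\sum_(a < p.+2) \sum_(pi : {ffun slot -> 'I_p.+2} | pi v0 == 0) G pi).
  apply: eq_bigr => a _.
  rewrite (reindex_onto (fun pi : {ffun slot -> 'I_p.+2} => [ffun w => pi w + a])
     (fun pi : {ffun slot -> 'I_p.+2} => [ffun w => pi w - a])) /=; last first.
    by move=> pi _; apply/ffunP => w; rewrite !ffunE subrK.
  apply: eq_big => [pi|pi _]; last exact: GE.
  rewrite ffunE -[X in _ + _ == X]add0r (inj_eq (addIr a)); apply/andb_idr => _.
  by apply/eqP/ffunP => w; rewrite !ffunE addrK.
by rewrite sumr_const card_ord -mulr_natr (pcharf0 charF) mulr0.
Qed.

(** Assumed for contradiction: an equivariant chain map from the chessboard join with apices to the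
    join of spheres. *)
Variable Phi : seq A -> seq T -> F.
Hypothesis Phi_nil : forall s, Phi [::] s = alt_nil F s.
Hypothesis Phi_bd : forall t s, bd (Phi t) s = cobd (fun u => Phi u s) t.
Hypothesis Phi_L : forall t, cface t -> sphere_chain q (size t) (Phi t).
Hypothesis Phi_shift : forall a t s, cface t ->
  Phi (map (@shift p _ a) t) (map (@shift p _ a) s) = Phi t s.

Let Phi' (t : seq B) := Phi (map (@emb q p) t).
Let Psi (t : seq B) : seq T -> F := alt_tuple F (map (@label q p) t).

Lemma cone_cobd a (G : seq T -> seq T -> F) t s :
  cone a (fun s => cobd (fun u => G u s) t) s = cobd (fun u => cone a (G u) s) t.
Proof.
elim: t G => [|b t IH] G /=; first exact: cone0.
rewrite -(IH (fun u => G (b :: u))) -mulN1r -cone_lin.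
by apply: cone_ext => u; rewrite mulN1r.
Qed.

Lemma alt_tuple_bd (t : seq T) s : bd (alt_tuple F t) s = cobd (fun u => alt_tuple F u s) t.
Proof.
elim: t s => [|a t IH] s; first by rewrite /bd big1.
rewrite /= bd_cone; congr (_ - _).
by rewrite -[RHS](cone_cobd a (fun u => alt_tuple F u)); apply: cone_ext.
Qed.

Lemma Psi_bd t s : bd (Psi t) s = cobd (fun u => Psi u s) t.
Proof. by rewrite alt_tuple_bd cobd_map. Qed.

Lemma Phi'_bd t s : bd (Phi' t) s = cobd (fun u => Phi' u s) t.
Proof. by rewrite Phi_bd cobd_map. Qed.

Lemma Phi'_L t : bface t -> sphere_chain q (size t) (Phi' t).
Proof. by rewrite -cface_emb => /Phi_L; rewrite size_map. Qed.

Lemma Phi'_shift a t s : bface t ->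
  Phi' (map (@shift p _ a) t) (map (@shift p _ a) s) = Phi' t s.
Proof. by move=> ft; rewrite /Phi' map_emb_shift Phi_shift// cface_emb. Qed.

Lemma Psi_shift a t s : Psi (map (@shift p _ a) t) (map (@shift p _ a) s) = Psi t s.
Proof.
by rewrite /Psi map_label_shift alt_tuple_map//; exact: shift_inj.
Qed.

(** A chain homotopy between [Psi] and [Phi'] has to satisfy [bd (D t) = defect D t]. On placements
    the defect is a cycle of top degree, which need not bound. *)
Definition defect (D : seq B -> seq T -> F) t s :=
  Phi' t s - Psi t s - cobd (fun u => D u s) t.

Definition homotopy n (D : seq B -> seq T -> F) := forall t, bface t -> (size t < n)%N ->
  [/\ sphere_chain q (size t).+1 (D t), forall s, bd (D t) s = defect D t s &
   forall a s, D (map (@shift p _ a) t) (map (@shift p _ a) s) = D t s].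

Lemma bd_cobd (D : seq B -> seq T -> F) t s :
  bd (fun s => cobd (fun u => D u s) t) s = cobd (fun u => bd (D u) s) t.
Proof.
elim: t D => [|b t IH] D /=; first by rewrite /bd big1.
rewrite -(IH (fun u => D (b :: u))) -mulN1r -bd_lin.
by apply: bd_ext => u; rewrite mulN1r.
Qed.

Lemma sphere_chain_cobd k (D : seq B -> seq T -> F) t :
  (forall u, subseq u t -> (size u).+1 = size t -> sphere_chain q k (D u)) ->
  sphere_chain q k (fun s => cobd (fun u => D u s) t).
Proof.
elim: t D => [|b t IH] D LD /=; first exact: sphere_chain0.
have L1 : sphere_chain q k (D t) by apply: LD; rewrite ?subseq_cons.
have := sphere_chain_lin (-1) L1 (IH (fun u => D (b :: u)) _); set c := fun s => _.
rewrite (_ : c = fun s => D t s - cobd (fun u => D (b :: u) s) t); last first.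
  by apply/funext => s; rewrite /c mulN1r.
by apply=> u ut su; apply: LD; rewrite /= ?eqxx ?su.
Qed.

Lemma defect_cycle n D t : homotopy n D -> bface t -> size t = n ->
  [/\ sphere_chain q n (defect D t), forall s, bd (defect D t) s = 0 &
   forall a s, defect D (map (@shift p _ a) t) (map (@shift p _ a) s) = defect D t s].
Proof.
move=> HD ft st.
have sub u : subseq u t -> (size u).+1 = size t -> bface u /\ (size u < n)%N.
  by move=> ut su; split; [exact: bface_subseq ft|rewrite -st -su].
have dE : defect D t = fun s => (Phi' t s + -1 * Psi t s) + -1 * cobd (fun u => D u s) t.
  by apply/funext => s; rewrite !mulN1r.
split.
- rewrite dE; apply: sphere_chain_lin; first apply: sphere_chain_lin.
  + by rewrite -st; apply: Phi'_L.
  + by rewrite -st; apply: sphere_chain_standard.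
  + apply: sphere_chain_cobd => u ut su; have [fu un] := sub u ut su.
    by have [] := HD u fu un; rewrite su st.
- move=> s; rewrite dE !bd_lin Phi'_bd Psi_bd bd_cobd !mulN1r.
  rewrite (@eq_cobd _ _ (fun u => bd (D u) s) (fun u => defect D u s)); last first.
    by move=> u ut su; have [fu un] := sub u ut su; have [] := HD u fu un.
  rewrite /defect (cobdB (fun u => Phi' u s - Psi u s)) cobdB.
  by rewrite (cobd_cobd (fun u => D u s)) subr0 subrr.
- move=> a s; rewrite /defect Phi'_shift// Psi_shift cobd_map; congr (_ - _).
  apply: eq_cobd => u ut su; have [fu un] := sub u ut su.
  by have [_ _] := HD u fu un; exact.
Qed.

(* Equivariance is arranged by choosing values only on tuples whose first vertex
   is at position [0]. *)
Lemma homotopy_exists n : (n <= q * p.+1)%N -> exists D, homotopy n D.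
Proof.
elim: n => [_|n IH nq]; first by exists (fun _ _ => 0).
have [D HD] := IH (ltnW nq).
have /choice[U HU] : forall t, exists u, bface t -> size t = n ->
    sphere_chain q n.+1 u /\ forall s, bd u s = defect D t s.
  move=> t; have [ft|nft] := boolP (bface t); last by exists (fun=> 0).
  have [st|/eqP nst] := eqVneq (size t) n; last by exists (fun=> 0) => _ /nst.
  have [Ld d0 _] := defect_cycle HD ft st.
  by have [u Lu uE] := sphere_chain_acyclic (leqnn q) nq Ld d0; exists u.
pose D' t s := if (size t < n)%N then D t s else
  if t is b :: _ then U (map (shift (- b.2)) t) (map (@shift p _ (- b.2)) s) else 0.
have D'E t : (size t < n)%N -> D' t = D t by rewrite /D'; move=> ->.
have dE t s : (size t <= n)%N -> defect D' t s = defect D t s.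
  move=> tn; rewrite /defect; congr (_ - _); apply: eq_cobd => u ut su.
  by rewrite D'E// su.
exists D' => t ft; rewrite ltnS leq_eqVlt => /orP[/eqP st|tn]; last first.
  have [L1 L2 L3] := HD t ft tn; rewrite D'E//; split=> // [s|a s].
    by rewrite dE ?L2// ltnW.
  by rewrite D'E ?size_map.
case: t => [|b t] in ft st *.
  (* The empty tuple has no first vertex to normalise; both maps send it to [alt_nil], so the
     homotopy is zero there. *)
  rewrite /D' -st /=; split=> //; first exact: sphere_chain0.
  by move=> s; rewrite /bd big1// /defect /= /Phi' /= Phi_nil /Psi subrr subr0.
set t' := b :: t in ft st *.
have t'0 : D' t' = fun s => U (map (shift (- b.2)) t') (map (@shift p _ (- b.2)) s).
  by apply/funext => s; rewrite /D' st ltnn.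
have [|LU UE] := HU (map (shift (- b.2)) t') _ (etrans (size_map _ _) st).
  by rewrite bface_shift.
split.
- by rewrite t'0 st; apply: sphere_chain_shift.
- move=> s; rewrite t'0 bd_map ?UE; last exact: shift_inj.
  by have [_ _ ->] := defect_cycle HD ft st; rewrite dE ?st.
- move=> a s; rewrite t'0 /D' size_map st ltnn [map _ t']/= -map_cons -/t'.
  congr U; last by rewrite map_shift opprD /= addrCA subrr addr0.
  rewrite -[LHS]map_comp; apply: eq_map => x /=.
  by rewrite shift_shift opprD addrCA subrr addr0.
Qed.

(** A placement together with the apex exceeds the top degree, so [Phi] vanishes on it. Its boundary
    formula then makes [Phi'] on placements the coboundary of the values on cones, which pairs to 0
    with the cycle. *)
Lemma Phi_placement_sum s :
  \sum_pi omega (map (@label q p) (placement pi)) * Phi' (placement pi) s = 0.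
Proof.
rewrite -[RHS](placement_cycle (fun u => Phi ((None, 0) :: map (@emb q p) u) s)).
apply: eq_bigr => pi _.
have [->|w0] := eqVneq (omega (map (@label q p) (placement pi))) 0; first by rewrite !mul0r.
have fpi := omega_bface w0.
congr (_ * _).
have LC := Phi_L (cface_cone fpi).
have C0 : forall s, Phi ((None, 0) :: map (@emb q p) (placement pi)) s = 0.
  by apply: sphere_chain_size0 LC; rewrite /= size_map size_placement.
have := Phi_bd ((None, 0) :: map (@emb q p) (placement pi)) s.
rewrite /bd big1 /= => [|x _]; last exact: C0.
by move/esym/eqP; rewrite subr_eq0 cobd_map => /eqP.
Qed.

Definition standard_facet := @facet q p q.

(** This sum is the degree of the standard map. All preimages of the facet count with the same sign
    because [omega] itself orients them. *)
Lemma Psi_placement_sum :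
  \sum_pi omega (map (@label q p) (placement pi)) * Psi (placement pi) standard_facet =
  #|[set pi | perm_eq standard_facet (map (@label q p) (placement pi))]|%:R.
Proof.
have [_ _ w1] := fundamentalP p F (leqnn q).
rewrite -sum1_card natr_sum [RHS]big_mkcond; apply: eq_bigr => pi _.
rewrite inE; case: ifPn => [H|].
  by rewrite alt_tuple_pairing ?w1//; exact: alternating_omega.
move=> nH; rewrite [Psi _ _](_ : _ = 0) ?mulr0//; apply/eqP; apply: contraNT nH => H.
exact: alt_tuple_supp H.
Qed.

Lemma placement_shift a (pi : {ffun slot -> 'I_p.+2}) :
  @placement q p [ffun w => pi w + a] = map (@shift p _ a) (placement pi).
Proof.
by rewrite /placement -[RHS]map_comp; apply: eq_map => w; rewrite /shift /comp ffunE.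
Qed.

(** Both [omega] and the defects are top cycles, hence shift invariant. With the equivariance of the
    defect the summand is invariant, and [sum_free] applies. *)
Lemma defect_placement_sum D s : homotopy (q * p.+1) D ->
  \sum_pi omega (map (@label q p) (placement pi)) * defect D (placement pi) s = 0.
Proof.
move=> HD; apply: sum_free => a pi; rewrite placement_shift map_label_shift.
have [Lw w0 _] := fundamentalP p F (leqnn q).
rewrite (top_cycle_shift charF _ _ Lw w0).
have [->|wn0] := eqVneq (omega (map (@label q p) (placement pi))) 0; first by rewrite !mul0r.
have [Ld d0 dS] := defect_cycle HD (omega_bface wn0) (size_placement pi).
congr (_ * _); rewrite -[RHS](top_cycle_shift charF (- a) s Ld d0) -(dS a).
by rewrite map_shift addNr map_shift0.
Qed.

(** Currying splits such a placement into one injection per colour, from its [p.+1] slots into the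
    [p.+1] nonzero positions. *)
Lemma card_standard_placement :
  #|[set pi | perm_eq standard_facet (map (@label q p) (placement pi))]| = (p.+1`! ^ q)%N.
Proof.
pose D := predC1 (0 : 'I_p.+2).
pose E := [set f : {ffun 'I_p.+1 -> 'I_p.+2} in ffun_on D | injectiveb f].
have cE : #|E| = p.+1`!.
  by rewrite card_inj_ffuns_on cardC1 !card_ord ffactnn.
pose cur (pi : {ffun slot -> 'I_p.+2}) : {ffun 'I_q -> {ffun 'I_p.+1 -> 'I_p.+2}} :=
  [ffun i => [ffun k => pi (i, k)]].
pose uncur (g : {ffun 'I_q -> {ffun 'I_p.+1 -> 'I_p.+2}}) : {ffun slot -> 'I_p.+2} :=
  [ffun w => g w.1 w.2].
have bcur : bijective cur.
  exists uncur => [pi|g]; first by apply/ffunP => -[i k]; rewrite !ffunE.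
  by apply/ffunP => i; apply/ffunP => k; rewrite !ffunE.
rewrite -[in RHS]cE -[in X in (_ ^ X)%N](card_ord q) -card_ffun_on.
rewrite -cardsE -(@on_card_preimset _ _ cur); last first.
  by case: bcur => h h1 h2; exists h => x _.
have [[aw fw] _ w1] := fundamentalP p F (leqnn q).
have wf : omega standard_facet != 0 by rewrite w1 oner_eq0.
have uf := alternating_uniq aw wf; have [_ sf] := fw _ wf.
apply: eq_card => pi; rewrite !inE.
have mE : map (@label q p) (placement pi) = [seq (v.1, pi v) | v <- enum slot].
  by rewrite -map_comp; apply: eq_map.
have plE i k : (i, pi (i, k)) \in map (@label q p) (placement pi).
  by rewrite mE; apply: (map_f (fun v : slot => (v.1, pi v)) (x := (i, k))); rewrite mem_enum.
apply/idP/ffun_onP => [H i|H].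
  have /injectiveP lI : injectiveb (fun v : slot => (v.1, pi v)).
    by rewrite /injectiveb /dinjectiveb -mE -(perm_uniq H).
  rewrite inE; apply/andP; split.
    apply/ffun_onP => k; rewrite !ffunE !inE.
    by have := plE i k; rewrite -(perm_mem H) mem_facet// => /andP[].
  apply/injectiveP => k1 k2; rewrite !ffunE => k12.
  by have /(congr1 snd) : (i, k1) = (i, k2) :> slot by apply: lI; rewrite /= k12.
have ul : uniq (map (@label q p) (placement pi)).
  rewrite mE; apply/injectiveP => -[i1 k1] [i2 k2] [<- k12]; congr pair.
  have := H i1; rewrite inE => /andP[_ /injectiveP]; apply.
  by rewrite !ffunE.
have ss : {subset map (@label q p) (placement pi) <= standard_facet}.
  move=> x; rewrite mE => /mapP[[i k] _ ->]; rewrite mem_facet//= ltn_ord /=.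
  by have := H i; rewrite inE => /andP[/ffun_onP/(_ k) + _]; rewrite !ffunE.
have [|_ H'] := uniq_min_size ul ss; first by rewrite sf size_map size_placement.
by apply: uniq_perm => // x; rewrite H'.
Qed.

Theorem no_chain_map : False.
Proof.
have [D HD] := homotopy_exists (leqnn _).
have := Phi_placement_sum standard_facet.
under eq_bigr => pi _.
  have -> : Phi' (placement pi) standard_facet = Psi (placement pi) standard_facet +
     (cobd (fun u => D u standard_facet) (placement pi) + defect D (placement pi) standard_facet).
    rewrite /defect; ring.
  rewrite mulrDr mulrDr; over.
rewrite !big_split /= Psi_placement_sum placement_cycle defect_placement_sum// !addr0.
rewrite card_standard_placement => /eqP; rewrite -(dvdn_pcharf charF).
have rp := pcharf_prime charF; rewrite Euclid_dvdX// => /andP[rf _].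
(* By Wilson's theorem [p.+2] divides the successor of the factorial of [p.+1], so it cannot divide
   that factorial. *)
by move: (rp); rewrite Wilson//= -[(_`!).+1]addn1 dvdn_addr// dvdn1.
Qed.

End NoChainMap.

(** * Barycentric subdivision *)

Section Subdivision.
Variables (R : realType) (P : normedModType R).
Implicit Types (t s u : seq P) (C : P -> Prop).

Definition bary t : P := (size t)%:R^-1 *: \sum_(x <- t) x.

(** The number [n] is fuel, equal to the size of [t] in use. Flags of faces are run through
    downwards, so the barycentre of the largest face comes first. *)
Fixpoint sdn (V : zmodType) n (phi : seq P -> V) t : V :=
  if n is n'.+1 then cobd (fun u => sdn n' (fun s => phi (bary t :: s)) u) t
  else phi t.

(* Value of the cochain [phi] on the barycentric subdivision of [t]. *)
Definition sd (V : zmodType) (phi : seq P -> V) t : V := sdn (size t) phi t.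

Definition bary_closed C := forall t, t != [::] -> (forall x, x \in t -> C x) -> C (bary t).

(** A substitute for lying in the convex hull. Instantiating [C] by a ball gives distance bounds,
    and by the points carried by a face gives support bounds. *)
Definition in_hull s t := forall C, bary_closed C ->
  (forall x, x \in t -> C x) -> forall x, x \in s -> C x.

Definition mesh (D : R) t := forall x y, x \in t -> y \in t -> `|x - y| <= D.

Lemma sdnB (V : zmodType) n (phi psi : seq P -> V) t :
  sdn n (fun u => phi u - psi u) t = sdn n phi t - sdn n psi t.
Proof.
elim: n phi psi t => [//|n IH] phi psi t /=; rewrite -cobdB.
by apply: eq_cobd => u _ _; rewrite IH.
Qed.

Lemma eq_sdn (V : zmodType) n (phi psi : seq P -> V) t :
  phi =1 psi -> sdn n phi t = sdn n psi t.
Proof. by move=> /funext ->. Qed.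

(** Subdivision is a chain map: omitting the barycentre of [t] gives the subdivided boundary, and
    the remaining terms form a double coboundary. *)
Lemma sdn_cobd (V : zmodType) n (phi : seq P -> V) t : size t = n ->
  sdn n (cobd phi) t = cobd (sdn n.-1 phi) t.
Proof.
elim: n phi t => [|n IH] phi t; first by case: t.
move=> st; rewrite [LHS]/= (eq_cobd (psi := fun u =>
  sdn n phi u - cobd (sdn n.-1 (fun s => phi (bary t :: s))) u)).
  by rewrite (cobdB (sdn n phi)) cobd_cobd subr0.
move=> u _; rewrite st => -[su] /=; rewrite -IH//.
exact: (sdnB n phi (cobd (fun s => phi (bary t :: s)))).
Qed.

Lemma sd_cobd (V : zmodType) (phi : seq P -> V) t : sd (cobd phi) t = cobd (sd phi) t.
Proof.
rewrite /sd sdn_cobd//; apply: eq_cobd => u _ <-; by rewrite /sd.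
Qed.

Lemma sdn_morph (V W : zmodType) (f : V -> W) n (phi : seq P -> V) t :
  (forall x y, f (x - y) = f x - f y) -> f (sdn n phi t) = sdn n (f \o phi) t.
Proof.
move=> fB; elim: n phi t => [//|n IH] phi t /=; rewrite (cobd_morph _ _ fB).
by apply: eq_cobd => u _ _ /=; rewrite IH.
Qed.

Lemma sdn_map (V : zmodType) (g : P -> P) n (phi : seq P -> V) t :
  (forall t, bary (map g t) = g (bary t)) ->
  sdn n phi (map g t) = sdn n (fun u => phi (map g u)) t.
Proof.
move=> gb; elim: n phi t => [//|n IH] phi t /=; rewrite cobd_map.
by apply: eq_cobd => u _ _; rewrite IH gb.
Qed.

Lemma size_neq0 t : t != [::] -> (size t)%:R != 0 :> R.
Proof. by rewrite pnatr_eq0 size_eq0. Qed.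

Lemma dist_bary b t : t != [::] ->
  `|b - bary t| <= (size t)%:R^-1 * \sum_(x <- t) `|b - x|.
Proof.
move=> t0; rewrite (_ : b - bary t = (size t)%:R^-1 *: \sum_(x <- t) (b - x)).
  rewrite normrZ ger0_norm ?invr_ge0//.
  by apply: ler_wpM2l; [rewrite invr_ge0|apply: ler_norm_sum].
rewrite big_split sumrN /= big_const_seq count_predT iter_addr_0 scalerDr scalerN.
by rewrite -[b *+ _]scaler_nat scalerA mulVf ?size_neq0// scale1r.
Qed.

Lemma ball_bary_closed b e : bary_closed (fun x => `|b - x| <= e).
Proof.
move=> t t0 te; apply: (le_trans (dist_bary b t0)).
rewrite ler_pdivrMl ?lt_def ?size_neq0//=.
rewrite big_seq (le_trans (ler_sum _ te))// -big_seq.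
by rewrite big_const_seq count_predT iter_addr_0 mulr_natl.
Qed.

Variable n0 : nat.
Hypothesis n0_gt0 : (0 < n0)%N.
Let kappa : R := 1 - n0%:R^-1.

Lemma kappa_ge0 : 0 <= kappa.
Proof. by rewrite subr_ge0 invf_le1 ?ler1n// ltr0n. Qed.

Lemma kappa_lt1 : kappa < 1.
Proof. by rewrite ltrBlDr ltrDl invr_gt0 ltr0n. Qed.

(** One of the averaged distances is that of [x] to itself, which gains a factor of one minus the
    inverse of [size t], at most [kappa]. *)
Lemma bary_mesh t D x : (size t <= n0)%N -> mesh D t -> x \in t ->
  `|bary t - x| <= kappa * D.
Proof.
move=> tn tD xt; have t0 : t != [::] by case: t xt {tn tD}.
have D0 : 0 <= D by rewrite (le_trans _ (tD _ _ xt xt)).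
rewrite distrC (le_trans (dist_bary x t0))//.
have st : (0 < size t)%N by rewrite lt0n size_eq0.
rewrite (perm_big _ (perm_to_rem xt)) big_cons subrr normr0 /= add0r.
have : \sum_(y <- rem x t) `|x - y| <= (size t).-1%:R * D.
  rewrite big_seq; apply: (@le_trans _ _ (\sum_(y <- rem x t | y \in rem x t) D)).
    apply: ler_sum => y yt; apply: tD => //; apply: mem_rem yt.
  by rewrite -big_seq big_const_seq count_predT iter_addr_0 size_rem// mulr_natl.
move=> /(ler_wpM2l (_ : 0 <= (size t)%:R^-1)) H; apply: (le_trans (H _)); rewrite ?invr_ge0//.
rewrite mulrA ler_wpM2r// -subn1 natrB// mulrBr mulVf ?size_neq0// mulr1.
by rewrite lerB// lef_pV2 ?posrE ?ltr0n// ler_nat.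
Qed.

Lemma in_hull_trans s t u : in_hull s t -> in_hull t u -> in_hull s u.
Proof. by move=> st tu C Cb Cu; apply: (st C Cb); apply: tu. Qed.

(** Properties stable under subtraction pass from the small simplices to the subdivided value; being
    a chain of the join and being zero are the two applications. *)
Lemma sdn_closed (V : zmodType) (Q : V -> Prop) n (phi : seq P -> V) t D :
  Q 0 -> (forall x y, Q x -> Q y -> Q (x - y)) -> (n <= n0)%N ->
  size t = n -> mesh D t ->
  (forall s, size s = n -> in_hull s t -> mesh (kappa * D) s -> Q (phi s)) ->
  Q (sdn n phi t).
Proof.
move=> Q0 QB; elim: n phi t => [|n IH] phi t nn st tD Qs.
  by case: t st tD Qs => // _ _; apply => // C.
apply: cobd_closed => // u ut; rewrite st => -[su].
have uT x : x \in u -> x \in t by apply: mem_subseq.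
have t0 : t != [::] by rewrite -size_eq0 st.
have D0 : 0 <= D.
  by case: t st tD {Qs ut uT t0} => // x t _ /(_ x x); rewrite subrr normr0 mem_head; apply.
apply: IH (ltnW nn) su _ _ => [x y /uT xt /uT yt|s ss hs ms]; first exact: tD.
have bs y : y \in s -> `|bary t - y| <= kappa * D.
  apply: (hs (fun y => `|bary t - y| <= kappa * D)); first exact: ball_bary_closed.
  by move=> x /uT xt; apply: bary_mesh; rewrite ?st.
apply: Qs => [|C Cb Ct x|x y]; first by rewrite /= ss.
  rewrite inE => /orP[/eqP->|xs]; first exact: Cb.
  by apply: (hs C Cb) xs => y /uT/Ct.
rewrite !inE => /orP[/eqP->|xs] /orP[/eqP->|ys]; rewrite ?subrr ?normr0 ?mulr_ge0 ?kappa_ge0//.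
- exact: bs.
- by rewrite distrC bs.
- exact: ms.
Qed.

Definition sdk (V : zmodType) k (phi : seq P -> V) := iter k (@sd V) phi.

Lemma sdk_cobd (V : zmodType) k (phi : seq P -> V) t : sdk k (cobd phi) t = cobd (sdk k phi) t.
Proof.
suff -> : sdk k (cobd phi) = cobd (sdk k phi) by [].
by elim: k => [//|k IH] /=; rewrite IH; apply/funext => s; rewrite sd_cobd.
Qed.

Lemma sdk_morph (V W : zmodType) (f : V -> W) k (phi : seq P -> V) t :
  (forall x y, f (x - y) = f x - f y) -> f (sdk k phi t) = sdk k (f \o phi) t.
Proof.
move=> fB; elim: k t => [//|k IH] t /=; rewrite /sd sdn_morph//.
by apply: eq_sdn => s /=; rewrite IH.
Qed.

Lemma sdkB (V : zmodType) k (phi psi : seq P -> V) t :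
  sdk k (fun u => phi u - psi u) t = sdk k phi t - sdk k psi t.
Proof.
elim: k t => [//|k IH] t /=; rewrite /sd -sdnB; apply: eq_sdn => s; exact: IH.
Qed.

Lemma sdk_map (V : zmodType) (g : P -> P) k (phi : seq P -> V) t :
  (forall t, bary (map g t) = g (bary t)) ->
  sdk k phi (map g t) = sdk k (fun u => phi (map g u)) t.
Proof.
move=> gb; elim: k t => [//|k IH] t /=; rewrite /sd sdn_map// size_map.
by apply: eq_sdn => s; rewrite IH.
Qed.

Lemma sdk_nil (V : zmodType) k (phi : seq P -> V) : sdk k phi [::] = phi [::].
Proof. by elim: k => [//|k IH]; rewrite /= /sd /= IH. Qed.

Lemma sdk_closed (V : zmodType) (Q : V -> Prop) k (phi : seq P -> V) t D :
  Q 0 -> (forall x y, Q x -> Q y -> Q (x - y)) ->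
  (size t <= n0)%N -> mesh D t ->
  (forall s, size s = size t -> in_hull s t -> mesh (kappa ^+ k * D) s -> Q (phi s)) ->
  Q (sdk k phi t).
Proof.
move=> Q0 QB; elim: k t D => [|k IH] t D tn tD Qs.
  by apply: Qs => // [C //|]; rewrite mul1r.
apply: (sdn_closed (D := D)) => // s ss hs ms; apply: (IH _ (kappa * D)) => //.
  by rewrite ss.
move=> u us hu mu; apply: Qs; rewrite ?us//; first exact: in_hull_trans hs.
by rewrite exprSr -mulrA.
Qed.

End Subdivision.

(** * An equivariant KKM-type theorem *)

Lemma uniq_map_inj (T1 T2 : eqType) (f : T1 -> T2) (s : seq T1) :
  uniq (map f s) -> {in s &, injective f}.
Proof.
elim: s => [//|a s IH] /= /andP[fas us] x y; rewrite !inE.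
move=> /orP[/eqP->|xs] /orP[/eqP->|ys] // fxy; last exact: IH.
- by move: fas; rewrite fxy map_f.
- by move: fas; rewrite -fxy map_f.
Qed.

Section Configuration.
Variables (R : realType) (q p : nat).
Hypothesis q_gt0 : (0 < q)%N.
Hypothesis r_prime : prime p.+2.
Local Notation slot := (slot q p).
Definition vertex : finType := (option slot * 'I_p.+2)%type.
Definition space := 'rV[R]_#|vertex|.
Let T := ('I_q * 'I_p.+2)%type.

Definition crd (x : space) (a : vertex) : R := x 0 (enum_rank a).

Definition of_crd (g : vertex -> R) : space := \row_k g (enum_val k).

Lemma of_crdE g a : crd (of_crd g) a = g a.
Proof. by rewrite /crd mxE enum_rankK. Qed.

Lemma crd_inj x y : crd x =1 crd y -> x = y.
Proof.
move=> xy; apply/rowP => k; rewrite -(enum_valK k); exact: xy.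
Qed.

Definition unit_pt (a : vertex) : space := of_crd (fun b => (a == b)%:R).

Definition move_pt (a : 'I_p.+2) (x : space) : space :=
  of_crd (fun b => crd x (shift (- a) b)).

Definition conflict (a b : vertex) :=
  (a.1 == b.1) || ((omap fst a.1 == omap fst b.1) && (a.2 == b.2)).

(* The pairwise product conditions say that the support is a face of the join of
   the chessboard complexes and of the possible positions of the apex. *)
Definition config (x : space) :=
  [/\ forall a, 0 <= crd x a, \sum_a crd x a = 1 &
   forall a b, a != b -> conflict a b -> crd x a * crd x b = 0].

Lemma crdZ k x a : crd (k *: x) a = k * crd x a.
Proof. by rewrite /crd mxE. Qed.

Lemma crd_sum (t : seq space) a : crd (\sum_(x <- t) x) a = \sum_(x <- t) crd x a.
Proof. by rewrite /crd summxE. Qed.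

Lemma move_pt_bary a (t : seq space) : bary (map (move_pt a) t) = move_pt a (bary t).
Proof.
apply: crd_inj => b; rewrite of_crdE !crdZ !crd_sum size_map big_map.
by congr (_ * _); apply: eq_bigr => x _; rewrite of_crdE.
Qed.

Lemma move_pt_unit a b : move_pt a (unit_pt b) = unit_pt (shift a b).
Proof.
apply: crd_inj => c; rewrite !of_crdE; congr (_%:R); congr nat_of_bool.
apply/eqP/eqP => [->|<-]; first by rewrite shift_shift addNr shift0.
by rewrite shift_shift subrr shift0.
Qed.

Lemma conflict_shift a b c : conflict (shift a b) (shift a c) = conflict b c.
Proof. by rewrite /conflict /= (inj_eq (addIr a)). Qed.

Lemma move_pt_config a x : config x -> config (move_pt a x).
Proof.
move=> [x0 x1 xc]; split=> [b|| b c bc cbc]; first by rewrite of_crdE.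
  rewrite (reindex_inj (@shift_inj p _ a)) -[RHS]x1; apply: eq_bigr => b _.
  by rewrite of_crdE shift_shift subrr shift0.
by rewrite !of_crdE xc ?conflict_shift// (inj_eq (@shift_inj p _ _)).
Qed.

Lemma move_pt0 x : move_pt 0 x = x.
Proof. by apply: crd_inj => b; rewrite of_crdE oppr0 shift0. Qed.

Lemma move_ptD a b x : move_pt a (move_pt b x) = move_pt (a + b) x.
Proof. by apply: crd_inj => c; rewrite !of_crdE shift_shift opprD. Qed.

Definition carried (t : seq vertex) (x : space) :=
  [/\ forall a, 0 <= crd x a, \sum_a crd x a = 1 & forall a, a \notin t -> crd x a = 0].

Lemma carried_bary_closed t : bary_closed (carried t).
Proof.
move=> s s0 sC; have sz := size_neq0 s0.
split=> [a||a at_].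
- rewrite crdZ crd_sum mulr_ge0 ?invr_ge0// big_seq sumr_ge0// => x /sC[x0 _ _]; exact: x0.
- under eq_bigr do rewrite crdZ crd_sum.
  rewrite -mulr_sumr exchange_big big_seq /= (eq_bigr (fun=> 1)); last first.
    by move=> x /sC[].
  by rewrite -big_seq big_const_seq count_predT iter_addr_0 mulVf.
- rewrite crdZ crd_sum big_seq big1 ?mulr0// => x /sC[_ _]; exact.
Qed.

Lemma carried_unit t a : a \in t -> carried t (unit_pt a).
Proof.
move=> at_; split=> [b||b bt]; rewrite ?of_crdE ?ler0n//.
  rewrite (bigD1 a)//= of_crdE eqxx big1 ?addr0// => b ba.
  by rewrite of_crdE eq_sym (negPf ba).
by case: eqP => // ab; move: bt; rewrite -ab at_.
Qed.

Lemma carried_config t x : cface t -> carried t x -> config x.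
Proof.
move=> /andP[t1 t2] [x0 x1 xt]; split=> // a b ab cab.
have [at_|/xt->] := boolP (a \in t); last by rewrite mul0r.
have [bt|/xt->] := boolP (b \in t); last by rewrite mulr0.
move: cab ab => /orP[/eqP ab1|]; first by rewrite (uniq_map_inj t1 at_ bt ab1) eqxx.
move=> /andP[/eqP ab1 /eqP ab2].
have E : (omap fst a.1, a.2) = (omap fst b.1, b.2) by rewrite ab1 ab2.
by rewrite (uniq_map_inj t2 at_ bt E) eqxx.
Qed.

(* The position of the first occupied slot trivializes the action. *)
Definition anchor_slot (x : space) :=
  [pick v : option slot | [exists j, crd x (v, j) != 0]].

Definition anchor (x : space) : 'I_p.+2 :=
  if anchor_slot x is Some v then odflt 0 [pick j | crd x (v, j) != 0] else 0.

Lemma anchor_move a x : config x -> anchor (move_pt a x) = anchor x + a.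
Proof.
move=> [x0 x1 xc]; rewrite /anchor.
have -> : anchor_slot (move_pt a x) = anchor_slot x.
  apply: eq_pick => v; apply/existsP/existsP => -[j]; last first.
    by move=> vj; exists (j + a); rewrite of_crdE /shift /= addrK.
  by rewrite of_crdE => vj; exists (j - a).
rewrite /anchor_slot; case: pickP => [v /existsP[j vj]|nv]; last first.
  have : \sum_a crd x a = 0.
    rewrite big1// => -[v j] _; have := nv v => /existsPn/(_ j); by rewrite negbK => /eqP.
  by rewrite x1 => /eqP; rewrite oner_eq0.
have jE k : crd x (v, k) != 0 -> k = j.
  move=> vk; apply/eqP; apply: contraTT isT => kj.
  have := xc (v, k) (v, j); rewrite /conflict eqxx xpair_eqE eqxx /= => /(_ kj isT) /eqP.
  by rewrite mulf_eq0 (negPf vk) (negPf vj).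
case: pickP => [k|/(_ (j + a))]; last by rewrite of_crdE /shift /= addrK vj.
rewrite of_crdE /shift /= => /jE kj; case: pickP => [l /jE ->|/(_ j)]; last by rewrite vj.
by rewrite /= -kj subrK.
Qed.

Lemma mesh_unit : exists D : R, forall t, mesh D (map unit_pt t).
Proof.
exists (\sum_a \sum_b `|unit_pt a - unit_pt b|) => t _ _ /mapP[a _ ->] /mapP[b _ ->].
rewrite (bigD1 a)//= (bigD1 b)//= -addrA lerDl addr_ge0 ?sumr_ge0// => c _.
exact: sumr_ge0.
Qed.

Lemma expr_small (k D e : R) : 0 <= k -> k < 1 -> 0 < e -> exists n, k ^+ n * D < e.
Proof.
move=> k0 k1 e0.
have D0 : 0 < `|D| + 1 by rewrite ltr_pwDr.
have : (k ^+ n @[n --> \oo] --> 0)%classic by apply: cvg_expr; rewrite ger0_norm.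
move/cvgrPdist_lt/(_ (e / (`|D| + 1))); rewrite divr_gt0// => /(_ isT)[n _ /(_ n (leqnn n))].
rewrite /= sub0r normrN ger0_norm ?exprn_ge0// ltr_pdivlMr// => H; exists n.
apply: le_lt_trans H; rewrite ler_wpM2l ?exprn_ge0//.
by rewrite (le_trans (ler_norm D))// lerDl.
Qed.

(** If no small simplex carried a full row of labels, labelling the vertices of a fine subdivision
    would yield the chain map excluded by [no_chain_map]. *)
Theorem equivariant_kkm (Lc : space -> T -> Prop) (delta : R) : 0 < delta ->
  (forall x, config x -> exists l, Lc x l) ->
  (forall a x l, config x -> Lc x l -> Lc (move_pt a x) (shift a l)) ->
  exists i (y : 'I_p.+2 -> space), forall j,
    [/\ config (y j), Lc (y j) (i, j) & forall k, `|y j - y k| < delta].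
Proof.
move=> delta0 Lex Lmove; apply: contrapT => Hno.
have [F charF] : exists F : fieldType, p.+2 \in [pchar F].
  by exists 'F_p.+2; exact: pchar_Fp.
have /choice[pk pkP] : forall x, exists l, config x -> Lc x l.
  move=> x; have [/Lex[l xl]|nx] := pselect (config x); first by exists l.
  by exists (Ordinal q_gt0, 0).
(* An arbitrary choice of labels is made equivariant by choosing at the translate with anchor 0 and
   shifting the label back. *)
pose lam x := shift (anchor x) (pk (move_pt (- anchor x) x)).
have lamP x : config x -> Lc x (lam x).
  move=> cx; rewrite -[x in Lc x]move_pt0 -(subrr (anchor x)) -move_ptD.
  by apply: Lmove; [exact: move_pt_config|apply/pkP/move_pt_config].
have lam_move a x : config x -> lam (move_pt a x) = shift a (lam x).
  move=> cx; rewrite /lam anchor_move// move_ptD opprD -addrA addNr addr0.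
  by rewrite /shift /= addrA.
pose n0 := #|vertex|.+1.
have [D HD] := mesh_unit.
have n0_gt0 : (0 < n0)%N by [].
have [k kP] := expr_small D (kappa_ge0 R n0_gt0) (kappa_lt1 R n0_gt0) delta0.
pose phi (s : seq space) : seq T -> F := alt_tuple F (map lam s).
pose Phi (t : seq vertex) := sdk k phi (map unit_pt t).
have cface_size t : cface t -> (size (map unit_pt t) <= n0)%N.
  move=> /andP[/map_uniq ut _]; rewrite size_map -(card_uniqP ut) ltnW// ltnS.
  exact: max_card.
have hull_config t s : cface t -> in_hull s (map unit_pt t) -> forall x, x \in s -> config x.
  move=> ft hs x xs; apply: (carried_config ft).
  apply: (hs _ (@carried_bary_closed t) _ x xs) => y /mapP[a at_ ->].
  exact: carried_unit.
apply: (@no_chain_map q p F q_gt0 charF Phi) => [s|t s|t ft|a t s ft].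
- by rewrite /Phi sdk_nil.
- have := @sdk_morph R space (seq T -> F) F (fun c => bd c s) k phi (map unit_pt t) _.
  rewrite /Phi => ->; last first.
    by move=> c1 c2; rewrite /bd -sumrB.
  rewrite (_ : _ \o phi = cobd (fun u => phi u s)); last first.
    apply/funext => u; rewrite /= /phi alt_tuple_bd cobd_map//.
  rewrite sdk_cobd cobd_map; apply: eq_cobd => u _ _.
  by rewrite -(@sdk_morph R space (seq T -> F) F (fun c => c s)).
- apply: (@sdk_closed _ _ n0 _ _ _ _ _ _ D) => //; first exact: sphere_chain0.
  + move=> c1 c2 L1 L2; have := sphere_chain_lin (-1) L1 L2.
    by congr sphere_chain; apply/funext => s; rewrite mulN1r.
  + exact: cface_size.
  + move=> s ss hs ms; rewrite /phi; split; first exact: alternating_tuple.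
    move=> u /alt_tuple_supp us; split; last by rewrite (perm_size us) size_map ss size_map.
    apply/andP; split; first by apply/allP.
    (* A full row among the labels of a small simplex provides exactly the points whose existence
       was denied. *)
    apply/forallP => i; apply/implyP => _; apply/row_fullP => H; apply: Hno; exists i.
    have /choice[y yP] : forall j, exists y, y \in s /\ lam y = (i, j).
      move=> j; have : (i, j) \in label_row p i by rewrite mem_label_row.
      by move/H; rewrite (perm_mem us) => /mapP[y ys ->]; exists y.
    exists y => j; have [yj lj] := yP j; have cj := hull_config _ _ ft hs _ yj.
    split=> // [|l]; first by rewrite -lj; exact: lamP.
    by apply: le_lt_trans kP; apply: ms => //; have [] := yP l.
- rewrite /Phi -map_comp.
  have -> : map (unit_pt \o shift a) t = map (move_pt a) (map unit_pt t).
    by rewrite -map_comp; apply: eq_map => b /=; rewrite move_pt_unit.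
  rewrite sdk_map; last exact: move_pt_bary.
  (* [lam] is known to be equivariant only at configurations, so the difference is shown to vanish
     on each simplex of the subdivision, whose vertices are configurations. *)
  apply/eqP; rewrite -subr_eq0; apply/eqP.
  pose psi1 u := phi (map (move_pt a) u) (map (@shift p _ a) s).
  pose psi2 u := phi u s.
  have := sdkB k psi1 psi2 (map unit_pt t).
  rewrite (@sdk_closed _ _ n0 _ _ (fun x => x = 0) _ _ _ D)//; first last.
  + move=> u su hu _; rewrite /psi1 /psi2 /phi; apply/eqP; rewrite subr_eq0; apply/eqP.
    rewrite -(@alt_tuple_map _ F (map lam u) (shift a)); last exact: shift_inj.
    congr (alt_tuple F _ _); rewrite -!map_comp; apply/eq_in_map => x xu /=.
    by rewrite lam_move//; apply: hull_config ft hu _ xu.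
  + exact: cface_size.
  + by move=> x y -> ->; rewrite subr0.
  rewrite -(@sdk_morph R space (seq T -> F) F (fun c => c s) k phi)//.
  rewrite -(@sdk_morph R space (seq T -> F) F (fun c => c (map (shift a) s)) k
    (fun u => phi (map (move_pt a) u)))//.
Qed.

End Configuration.

(** * From labellings to constant rows, by compactness *)

Section ConstantRows.
Local Open Scope classical_set_scope.
Variables (R : realType) (q p : nat).
Hypothesis q_gt0 : (0 < q)%N.
Hypothesis r_prime : prime p.+2.
Local Notation vertex := (vertex q p).
Local Notation space := (space R q p).
Local Notation config := (@config R q p).
Let T := ('I_q * 'I_p.+2)%type.

Lemma cvg_sum_real (I : finType) (U : Type) (G : set_system U) (f : I -> U -> R) (a : I -> R) :
  Filter G -> (forall i, f i x @[x --> G] --> a i) ->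
  \sum_i f i x @[x --> G] --> \sum_i a i.
Proof.
by move=> FG fa; apply: cvg_big => [|i _]; [exact: add_continuous|exact: fa].
Qed.

Lemma crd_continuous a : continuous (fun x : space => crd x a).
Proof. exact: coord_continuous. Qed.

Lemma compact_config : compact (config : set space).
Proof.
apply: (@subclosed_compact _ _ [set v : space | forall i, `[0, 1]%classic (v ord0 i)]).
- rewrite (_ : (config : set space) =
      (\bigcap_(a in [set: vertex]) (fun x => crd x a) @^-1` [set y | 0 <= y]) `&`
      ((fun x : space => \sum_a crd x a) @^-1` [set y | y = 1]) `&`
      \bigcap_(a in [set c : vertex * vertex | c.1 != c.2 /\ conflict c.1 c.2])
        (fun x : space => crd x a.1 * crd x a.2) @^-1` [set y | y = 0]); last first.
    apply/seteqP; split=> x /=.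
      by move=> [x0 x1 xc]; split; [split=> // a _; exact: x0|move=> [a b] [/=]; exact: xc].
    by move=> [[x0 x1] xc]; split=> // [a|a b ab cab]; [exact: x0|exact: (xc (a, b))].
  apply: closedI; first apply: closedI.
  + apply: closed_bigI => a _.
    by have /continuous_closedP := @crd_continuous a; apply; exact: closed_ge.
  + suff /continuous_closedP : continuous (fun x : space => \sum_a crd x a).
      by apply; exact: closed_eq.
    by move=> x; apply: (@cvg_sum_real _ _ (nbhs (x : space))) => a; exact: crd_continuous.
  + apply: closed_bigI => -[a b] _.
    suff /continuous_closedP : continuous (fun x : space => crd x a * crd x b).
      by apply; exact: closed_eq.
    by move=> x; exact: (cvgM (@crd_continuous a x) (@crd_continuous b x)).
- apply: (@rV_compact R _ (fun=> `[0, 1]%classic)) => i; exact: segment_compact.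
- move=> x [x0 x1 _] i /=; rewrite in_itv /= -(enum_valK i).
  rewrite -[x _ _]/(crd x (enum_val i)) x0 /= -x1 (bigD1 (enum_val i))//= lerDl.
  exact: sumr_ge0.
Qed.

(** Without such a point, near each configuration every row misses some label. Compactness makes the
    radius uniform, against the arbitrarily small full rows of [equivariant_kkm]. *)
Theorem exists_constant_rows (rho : 'I_q -> space -> 'I_p.+2 -> R) :
  (forall i j x, config x -> rho i y j @[y --> within config (nbhs x)] --> rho i x j) ->
  (forall a i j x, config x -> rho i (move_pt a x) (j + a) = rho i x j) ->
  exists2 x, config x & forall i j k, rho i x j = rho i x k.
Proof.
move=> rho_cont rho_move; apply: contrapT => Hno.
pose osc i x := \sum_j \sum_k `|rho i x j - rho i x k|.
have osc_ge0 i x : 0 <= osc i x by apply: sumr_ge0 => j _; apply: sumr_ge0.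
have osc_cont i x : config x -> osc i y @[y --> within config (nbhs x)] --> osc i x.
  move=> cx; apply: cvg_sum_real => j; apply: cvg_sum_real => k.
  by apply: cvg_norm; apply: cvgB; exact: rho_cont.
have osc0 i x : osc i x = 0 -> forall j k, rho i x j = rho i x k.
  move=> /eqP; rewrite psumr_eq0 => [/allP o0 j k|j _]; last exact: sumr_ge0.
  have := o0 j (mem_index_enum _); rewrite /= psumr_eq0// => /allP/(_ k (mem_index_enum _)) /=.
  by rewrite normr_eq0 subr_eq0 => /eqP.
pose Lc x (l : T) := (forall i, osc i x <= osc l.1 x) /\ forall k, rho l.1 x k <= rho l.1 x l.2.
have Lex x : config x -> exists l, Lc x l.
  move=> cx; pose i := [arg max_(i > Ordinal q_gt0) osc i x]%O.
  pose j := [arg max_(j > 0) rho i x j]%O; exists (i, j); split=> /= [i'|k].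
    by rewrite /i; case: arg_maxP => // ? _; exact.
  by rewrite /j; case: arg_maxP => // ? _; exact.
have osc_move a i x : config x -> osc i (move_pt a x) = osc i x.
  move=> cx; rewrite /osc (reindex_inj (addIr a)); apply: eq_bigr => j _.
  by rewrite (reindex_inj (addIr a)); apply: eq_bigr => k _; rewrite !rho_move.
have Lmove a x l : config x -> Lc x l -> Lc (move_pt a x) (shift a l).
  move=> cx [L1 L2]; split=> [i|k] /=; first by rewrite !osc_move.
  by rewrite -[k](subrK a) !rho_move.
have bad x : config x -> exists J : 'I_q -> 'I_p.+2,
    \forall y \near within config (nbhs x), forall i, ~ Lc y (i, J i).
  move=> cx; suff /choice[J JP] : forall i, exists j,
      \forall y \near within config (nbhs x), ~ Lc y (i, j).
    by exists J; exact: filter_forall.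
  move=> i; have [osc_x0|osc_x0] := eqVneq (osc i x) 0.
    have [i' oi'] : exists i', osc i' x != 0.
      apply: contrapT => no; apply: Hno; exists x => // k; apply: osc0.
      by apply/eqP/negPn/negP => ok; apply: no; exists k.
    (* Any position would do: near [x] the row [i'] oscillates strictly more than row [i], so row
       [i] is never selected. *)
    exists 0.
    have D : osc i' y - osc i y @[y --> within config (nbhs x)] --> osc i' x - osc i x.
      by apply: cvgB; exact: osc_cont.
    have : \forall y \near within config (nbhs x), 0 < osc i' y - osc i y.
      by apply: (cvgr_gt _ D); rewrite osc_x0 subr0 lt_def oi' osc_ge0.
    by apply: filterS => y /=; rewrite subr_gt0 => lt_o [/(_ i')]; rewrite leNgt lt_o.
  have [j [k jk]] : exists j k, rho i x j < rho i x k.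
    apply: contrapT => no; case/eqP: osc_x0; apply: big1 => j _; apply: big1 => k _.
    apply/eqP; rewrite normr_eq0 subr_eq0 eq_le !leNgt; apply/andP.
    by split; apply/negP => ?; apply: no; [exists k, j|exists j, k].
  (* Near [x] position [j] stays strictly below position [k] in row [i], hence is not a maximum. *)
  exists j.
  have D : rho i y k - rho i y j @[y --> within config (nbhs x)] --> rho i x k - rho i x j.
    by apply: cvgB; exact: rho_cont.
  have : \forall y \near within config (nbhs x), 0 < rho i y k - rho i y j.
    by apply: (cvgr_gt _ D); rewrite subr_gt0.
  by apply: filterS => y /=; rewrite subr_gt0 => lt_r [_ /(_ k)]; rewrite leNgt lt_r.
pose far (e : R) x := ~ exists i (y : 'I_p.+2 -> space),
  forall j, [/\ config (y j), Lc (y j) (i, j) & `|x - y j| < e].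
have Hfar : \forall e \near 0^'+, config `<=` far e.
  move: compact_config => /compact_near_coveringP; apply => x cx.
  have [J] := bad x cx; rewrite near_withinE => /nbhs_ballP[e0 /= e00 HJ].
  have e20 : 0 < e0 / 2 by rewrite divr_gt0.
  (* Half of the radius is for moving the centre from [x] to [x'], half for the distance from [x']
     to the labelled point. *)
  exists (ball x (e0 / 2), [set e : R | e < e0 / 2]) => /=.
    by split; [exact: nbhsx_ballx|exact: nbhs_right_lt].
  move=> [x' e] /= [xx' ee] [i [y Hy]]; have [cy Ly dy] := Hy (J i).
  apply: (HJ (y (J i))) Ly => //.
  rewrite [e0]splitr; apply: ball_triangle xx' _.
  by rewrite -ball_normE /=; exact: lt_trans ee.
have [e [He e0]] : exists e : R, config `<=` far e /\ 0 < e.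
  by apply: (@filter_ex _ (0^'+ : set_system R)); apply: filterI => //; exact: nbhs_right_gt.
have [i [y Hy]] := equivariant_kkm q_gt0 r_prime e0 Lex Lmove.
have [c0 _ _] := Hy 0; apply: (He _ c0); exists i, y => j.
by have [? ?] := Hy j; split=> //; have [_ _] := Hy 0; exact.
Qed.

End ConstantRows.

(** * Reduction of the coloured Tverberg theorem *)

Section Reduction.
Variables (R : realType) (p d m n : nat).
Let N := (p.+1 * d.+1)%N.
Local Notation q := m.+1.
Local Notation slot := (slot q p).
Local Notation space := (space R q p).
Variable v : 'I_N.+1 -> 'rV[R]_n.
Variable f : 'rV[R]_n -> 'rV[R]_d.
Hypothesis f_cont : {within simplex_points v, continuous f}%classic.
Variable place : 'I_N.+1 -> slot.
Hypothesis place_inj : injective place.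

Let some_place (u : 'I_N.+1) : option slot := Some (place u).

(** The apex [None] is never a value of [some_place], so it counts as a dummy. *)
Definition dummies : seq (option slot) :=
  [seq w <- enum {: option slot} | w \notin codom some_place].

Lemma some_place_inj : injective some_place.
Proof. by move=> u u' [/place_inj]. Qed.

Lemma size_dummies : (size dummies + N.+1 = (q * p.+1).+1)%N.
Proof.
have cS : #|{: option slot}| = (q * p.+1).+1 by rewrite card_option card_prod !card_ord.
have cc : #|codom some_place| = N.+1 by rewrite card_codom ?card_ord//; exact: some_place_inj.
rewrite -cS -(cardC (mem (codom some_place))) cc addnC; congr addn.
by rewrite cardE /enum_mem -enumT.
Qed.

Definition weight (x : space) j : R := \sum_u crd x (some_place u, j).

Definition slack (x : space) j : R := `|p.+2%:R^-1 - weight x j|.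

(* Equals [p.+2 * crd x (some_place u, j)] when the weight of position [j] is
   [p.+2^-1]; the slack keeps the denominator positive everywhere. *)
Definition bcoord (x : space) j (u : 'I_N.+1) : R :=
  (crd x (some_place u, j) + slack x j * N.+1%:R^-1) / (weight x j + slack x j).

Definition bpoint x j : 'rV[R]_n := \sum_u bcoord x j u *: v u.

Definition dummy_group (w : option slot) := (index w dummies %/ p.+1)%N.

(** By [size_dummies] there are [(q - d.+1) * p.+1] dummies, so their groups fill exactly the rows
    left after the weights and the [d] coordinates. *)
Definition test_rows (i : 'I_q) (x : space) (j : 'I_p.+2) : R :=
  if i : nat is i'.+1 then
    if insub i' is Some k then f (bpoint x j) 0 (k : 'I_d)
    else \sum_(w <- dummies | (d + dummy_group w)%N == i') crd x (w, j)
  else weight x j.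

Lemma crd_move a (x : space) (w : option slot) j : crd (move_pt a x) (w, j + a) = crd x (w, j).
Proof. by rewrite of_crdE /shift /= addrK. Qed.

Lemma test_rows_move a i j (x : space) : test_rows i (move_pt a x) (j + a) = test_rows i x j.
Proof.
have wE : weight (move_pt a x) (j + a) = weight x j.
  by apply: eq_bigr => u _; rewrite crd_move.
have bE : bpoint (move_pt a x) (j + a) = bpoint x j.
  by apply: eq_bigr => u _; rewrite /bcoord /slack wE crd_move.
rewrite /test_rows; case: (i : nat) => [//|i']; case: insub => [k|]; first by rewrite bE.
by apply: eq_bigr => w _; rewrite crd_move.
Qed.

Lemma denominator_gt0 x j : 0 < weight x j + slack x j.
Proof.
have r0 : 0 < p.+2%:R^-1 :> R by rewrite invr_gt0 ltr0n.
apply: (lt_le_trans r0); rewrite addrC -lerBlDr; exact: ler_norm.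
Qed.

Lemma bcoord_ge0 x j u : config x -> 0 <= bcoord x j u.
Proof.
move=> [x0 _ _]; apply: divr_ge0; last exact/ltW/denominator_gt0.
by apply: addr_ge0; [exact: x0|apply: mulr_ge0; [exact: normr_ge0|rewrite invr_ge0 ler0n]].
Qed.

Lemma sum_bcoord x j : \sum_u bcoord x j u = 1.
Proof.
rewrite -mulr_suml big_split /= sumr_const card_ord
  -[(slack x j * _) *+ _]mulr_natr mulfVK ?pnatr_eq0//.
by rewrite divff// gt_eqF// denominator_gt0.
Qed.

Lemma bpoint_face x j (F : {set 'I_N.+1}) : config x ->
  (forall u, u \notin F -> bcoord x j u = 0) -> face_points v F (bpoint x j).
Proof.
move=> cx F0; exists (bcoord x j); split=> //; last exact: sum_bcoord.
by move=> u; exact: bcoord_ge0.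
Qed.

Local Open Scope classical_set_scope.

Lemma cvg_sum_normed (K : normedModType R) (I : finType) (U : Type) (G : set_system U)
    (g : I -> U -> K) (a : I -> K) :
  Filter G -> (forall i, g i x @[x --> G] --> a i) ->
  \sum_i g i x @[x --> G] --> \sum_i a i.
Proof.
by move=> FG fa; apply: cvg_big => [|i _]; [exact: add_continuous|exact: fa].
Qed.

Lemma weight_continuous j : continuous (fun x : space => weight x j).
Proof.
move=> x; apply: (@cvg_sum_real _ _ _ (nbhs (x : space))) => a; exact: crd_continuous.
Qed.

Lemma slack_continuous j : continuous (fun x : space => slack x j).
Proof.
move=> x; apply: (@cvg_norm _ _ _ (nbhs (x : space))).
by apply: (@cvgB _ _ _ (nbhs (x : space))); [exact: cvg_cst|exact: weight_continuous].
Qed.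

Lemma bcoord_continuous j u : continuous (fun x : space => bcoord x j u).
Proof.
move=> x; apply: (@cvgM _ _ (nbhs (x : space))).
  apply: (@cvgD _ _ _ (nbhs (x : space))); first exact: crd_continuous.
  by apply: (@cvgM _ _ (nbhs (x : space))); [exact: slack_continuous|exact: cvg_cst].
apply: (@cvgV _ _ (nbhs (x : space))); first by rewrite gt_eqF// denominator_gt0.
by apply: (@cvgD _ _ _ (nbhs (x : space))); [exact: weight_continuous|exact: slack_continuous].
Qed.

Lemma bpoint_continuous j : continuous (fun x : space => bpoint x j).
Proof.
move=> x; apply: (@cvg_sum_normed _ _ _ (nbhs (x : space))) => u.
by apply: (@cvgZl _ _ _ (nbhs (x : space))); exact: bcoord_continuous.
Qed.

Lemma test_rows_continuous i j x : config x ->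
  test_rows i y j @[y --> within (@config R q p) (nbhs x)] --> test_rows i x j.
Proof.
move=> cx; rewrite /test_rows; case: (i : nat) => [|i'].
  by apply: cvg_within_filter; exact: weight_continuous.
case: insub => [k|]; last first.
  apply: cvg_within_filter.
  apply: cvg_big => [|w _]; [exact: add_continuous|exact: crd_continuous].
(* [f] is continuous only on the simplex, which is why limits are taken within the configurations:
   there [bpoint] stays in the simplex. *)
have H : f (bpoint y j) @[y --> within (@config R q p) (nbhs x)] --> f (bpoint x j).
  move/subspace_continuousP : f_cont => /(_ (bpoint x j)) fc.
  have sx y : config y -> simplex_points v (bpoint y j).
    by move=> cy; apply: bpoint_face => // u; rewrite inE.
  have {}fc := fc (sx x cx).
  apply: (@cvg_comp _ _ _ (fun y : space => bpoint y j) f _ _ _ _ fc) => U.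
  rewrite /within /= => HU.
  have := @bpoint_continuous j x _ HU.
  apply: (@filterS _ (nbhs (x : space))) => y /= Hy cy; exact: Hy (sx y cy).
exact: (@cvg_comp _ _ _ (fun y : space => f (bpoint y j)) (fun M => M 0 k)
  _ _ _ H (@coord_continuous R 1 d 0 k (f (bpoint x j)))).
Qed.

Local Close Scope classical_set_scope.

Lemma dummies_uniq : uniq dummies.
Proof. exact/filter_uniq/enum_uniq. Qed.

Lemma size_dummy_group g : (size [seq w <- dummies | dummy_group w == g] <= p.+1)%N.
Proof.
rewrite -(size_map (index^~ dummies)) -[X in (_ <= X)%N](size_iota (g * p.+1)).
apply: uniq_leq_size.
  rewrite map_inj_in_uniq; first exact/filter_uniq/dummies_uniq.
  move=> w w'.
  rewrite mem_filter => /andP[_ wd]; rewrite mem_filter => /andP[_ wd'].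
  exact: (index_inj w wd wd').
move=> _ /mapP[w + ->]; rewrite mem_filter mem_iota => /andP[/eqP <- _].
by rewrite leq_trunc_div /= -mulSnr -ltn_divLR// leqnn.
Qed.

Lemma crd_slot (x : space) (w : option slot) j k :
  config x -> crd x (w, j) != 0 -> j != k -> crd x (w, k) = 0.
Proof.
move=> [_ _ xc] wj jk; apply/eqP.
have := xc (w, j) (w, k); rewrite xpair_eqE eqxx /= jk /conflict eqxx => /(_ isT isT)/eqP.
by rewrite mulf_eq0 (negPf wj).
Qed.

(** * Consequences of constant rows for weights, supports and images *)

Section Conclusion.
Variable x : space.
Hypothesis cx : config x.
Hypothesis x_const : forall i j k, test_rows i x j = test_rows i x k.
Hypothesis d_lt : (d.+1 < q)%N.

Lemma row_lt i : (i < q)%N -> exists k : 'I_q, k = i :> nat.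
Proof. by move=> iq; exists (Ordinal iq). Qed.

(* A group has at most [p.+1] dummies, so one of the [p.+2] positions holds
   none of them, and the row of the group vanishes there. *)
Lemma dummies_zero w j : w \in dummies -> crd x (w, j) = 0.
Proof.
have [x0 _ _] := cx; move=> wd; have gq : ((d + dummy_group w).+1 < q)%N.
  have : (dummy_group w < q - d.+1)%N.
    rewrite /dummy_group ltn_divLR//; have := wd; rewrite -index_mem => /leq_trans; apply.
    rewrite mulnBl leq_subRL; last by rewrite leq_mul2r ltnW ?orbT.
    have : (size dummies + d.+1 * p.+1).+1 = (q * p.+1).+1.
      by rewrite -size_dummies addnS /N [(d.+1 * _)%N]mulnC.
    by rewrite [X in (X <= _)%N]addnC => /succn_inj ->.
  by move: d_lt; lia.
have [i iE] := row_lt gq.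
have rE k : test_rows i x k = \sum_(w' <- dummies | dummy_group w' == dummy_group w) crd x (w', k).
  rewrite /test_rows iE; case: insubP => [? |_]; first by rewrite ltnNge leq_addr.
  by apply: eq_bigl => w'; rewrite eqn_add2l.
have [k k0] : exists k, test_rows i x k = 0.
  pose ws := [seq w' <- dummies | dummy_group w' == dummy_group w].
  pose pos w' : 'I_p.+2 := odflt 0 [pick l | crd x (w', l) != 0].
  have [k nk] : exists k, k \notin map pos ws.
    apply/existsP; apply: contraT => /existsPn H.
    have : (size (enum 'I_p.+2) <= size (map pos ws))%N.
      by apply: uniq_leq_size (enum_uniq _) _ => l _; have := H l; rewrite negbK.
    by rewrite size_enum_ord size_map leqNgt ltnS size_dummy_group.
  exists k; rewrite rE -big_filter big_seq big1// => w' w's; apply/eqP.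
  apply: contraR nk => w'k; apply/mapP; exists w' => //; rewrite /pos.
  case: pickP => [l wl|/(_ k)]; last by rewrite w'k.
  by apply/eqP; apply: contraTT wl => kl; rewrite (crd_slot cx w'k kl) eqxx.
have /eqP : test_rows i x j = 0 by rewrite (x_const i j k).
rewrite rE psumr_eq0// => /allP/(_ w wd); rewrite eqxx => /eqP; exact.
Qed.

(** The dummies carry nothing, so the equal weights of the [p.+2] positions add up to the total
    1. *)
Lemma weightE j : weight x j = p.+2%:R^-1.
Proof.
have [_ x1 _] := cx; have [i iE] := row_lt (ltn0Sn m : 0 < q)%N.
have wj k : weight x k = weight x j by have := x_const i k j; rewrite /test_rows iE.
have : \sum_k weight x k = 1.
  rewrite exchange_big /= -x1 (eq_bigr (fun a => crd x (a.1, a.2))); last by case.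
  rewrite -(pair_big predT predT (fun w k => crd x (w, k))) /=.
  rewrite [RHS](bigID (mem (codom some_place))) /= [X in _ + X]big1 ?addr0.
    rewrite -[RHS]big_uniq; first by rewrite big_image.
    by rewrite map_inj_uniq ?enum_uniq//; exact: some_place_inj.
  by move=> w wc; apply: big1 => k _; apply: dummies_zero; rewrite mem_filter wc mem_enum.
rewrite (eq_bigr (fun=> weight x j))// sumr_const card_ord => rw.
by apply: (mulfI (_ : p.+2%:R != 0)); rewrite ?pnatr_eq0// mulr_natl rw divff// pnatr_eq0.
Qed.

Lemma bcoord_supp j u : crd x (some_place u, j) = 0 -> bcoord x j u = 0.
Proof. by move=> u0; rewrite /bcoord u0 /slack weightE subrr normr0 mul0r addr0 mul0r. Qed.

Lemma f_bpointE j k : f (bpoint x j) = f (bpoint x k).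
Proof.
apply/rowP => l; have /row_lt[i iE] : (l.+1 < q)%N by exact: leq_ltn_trans (ltn_ord l) (ltnW d_lt).
have := x_const i j k; rewrite /test_rows iE; case: insubP => [l' _ l'l|]; last by rewrite ltn_ord.
by rewrite (_ : l' = l)//; exact: val_inj.
Qed.

End Conclusion.

End Reduction.

Theorem theorem2p1 (R : realType) (r d N m n : nat)
    (r_prime : prime r) (d_ge1 : (1 <= d)%N)
    (N_def : N = ((r - 1) * (d + 1))%N)
    (v : 'I_N.+1 -> 'rV[R]_n) (v_indep : affinely_independent v)
    (C : 'I_m.+1 -> {set 'I_N.+1}) (C_coloring : is_coloring C)
    (C_small : forall i, (#|C i| <= r - 1)%N)
    (f : 'rV[R]_n -> 'rV[R]_d)
    (f_cont : {within simplex_points v, continuous f}%classic) :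
  exists F : 'I_r -> {set 'I_N.+1},
    [/\ forall j k, j != k -> [disjoint F j & F k],
        forall i j, (#|C i :&: F j| <= 1)%N
      & (\bigcap_(j in [set: 'I_r]) (f @` face_points v (F j)) !=set0)%classic].
Proof.
case: r r_prime N_def C_small => [//|[//|p]] r_prime.
rewrite subn1 addn1 /= => NE C_small; subst N.
have [C_cover C_disj] := C_coloring.
have /choice[col colP] := C_cover.
(* The slot of a vertex is its rank in its own class; a class has at most [p.+1] elements, so
   [inord] never falls back to its default. *)
pose place u : slot m.+1 p := (col u, inord (index u (enum (C (col u))))).
have place_inj : injective place.
  move=> u u' [cE]; rewrite -cE => /(congr1 val).
  have lt w : col w = col u -> (index w (enum (C (col u))) < p.+1)%N.
    move=> cw; rewrite (leq_trans _ (C_small (col u)))// cardE index_mem mem_enum -cw; exact: colP.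
  rewrite /= !inordK ?lt// => /(index_inj u); apply; rewrite mem_enum// cE; exact: colP.
(* The apex makes the number of dummies positive, which by [size_dummies] forces strictly more than
   [d.+1] classes. *)
have d_lt : (d.+1 < m.+1)%N.
  have := size_dummies place_inj; have : (0 < size (dummies place))%N.
    rewrite -has_predT; apply/hasP; exists None => //.
    by rewrite mem_filter mem_enum andbT; apply/codomP => -[].
  by move=> ? ?; nia.
have [x cx x_const] := exists_constant_rows (ltn0Sn m) r_prime
  (test_rows_continuous f_cont (place := place))
  (fun a i j x _ => test_rows_move v f place a i j x).
have supp0 := bcoord_supp place_inj cx x_const d_lt.
(* Face [j] consists of the vertices placed at position [j]. One position per slot gives
   disjointness, and one slot per colour and position gives the colour condition. *)
exists (fun j => [set u | crd x (Some (place u), j) != 0]); split.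
- move=> j k jk; rewrite finset.disjoints_subset.
  apply/fintype.subsetP => u; rewrite !inE negbK => uj.
  by rewrite (crd_slot cx uj jk).
- move=> i j; apply/card_le1_eqP => u u'; rewrite !inE => /andP[ui uj] /andP[u'i u'j].
  have colE w : w \in C i -> col w = i.
    move=> wi; apply/eqP; apply: contraT => /C_disj; rewrite disjoint_sym => /disjointFr/(_ wi).
    by rewrite colP.
  apply/eqP; apply: contraT => uu'; have [_ _ xc] := cx.
  have := xc (Some (place u), j) (Some (place u'), j).
  rewrite xpair_eqE eqxx andbT (inj_eq (@Some_inj _)) (inj_eq place_inj).
  rewrite [u == u']eq_sym uu' /conflict /= !colE// !eqxx orbT.
  by move=> /(_ isT isT)/eqP; rewrite mulf_eq0 (negPf uj) (negPf u'j).
- exists (f (bpoint v place x 0)) => j _.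
  exists (bpoint v place x j); last exact: f_bpointE.
  apply: bpoint_face => // u; rewrite inE negbK => /eqP; exact: supp0.
Qed.
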